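(* Let $(\Delta,\mathbf{L})$ be a labelled compact convex simple polytope in $\mathbb{R}^m$ containing the origin, $f$ a positive affine linear function on $\Delta$, and $(\tilde\Delta,\tilde{\mathbf{L}})$ the $f$-twist of $(\Delta,\mathbf{L})$. Then $(\Delta,\mathbf{L})$ is $(f,m+2)$-$K$-stable if and only if $(\tilde\Delta,\tilde{\mathbf{L}})$ is $K$-stable.
   Context: **Labelled polytopes.** A labelled compact convex simple polytope $(\Delta,\mathbf{L})$ in $\mathbb{R}^m$ is a compact convex simple polytope $\Delta$ with non-empty interior and $d$ facets $F_1,\dots,F_d$, together with a set $\mathbf{L}=\{L_1,\dots,L_d\}$ of affine linear functions such that $\Delta=\{x\in\mathbb{R}^m: L_i(x)\ge 0,\ i=1,\dots,d\}$ and $F_i=\Delta\cap\{L_i=0\}$. No integrality of the $dL_i$ is assumed. **$f$-twist.** Assume $0\in\Delta$ and $f$ is affine linear and positive on $\Delta$. Put $T(x)=\tilde x=x/f(x)$. The $f$-twist of $(\Delta,\mathbf{L})$ is $(\tilde\Delta,\tilde{\mathbf{L}})$ with $\tilde\Delta=T(\Delta)$ and $\tilde{\mathbf{L}}=\{\tilde L_1,\dots,\tilde L_d\}$, $\tilde L_i(\tilde x)=L_i(x)/f(x)$; this is again a labelled polytope (the $\tilde L_i$ are affine linear in $\tilde x$) containing the origin. **Stability.** Let $dx$ be Lebesgue measure on $\mathbb{R}^m$ and let $d\sigma$ be the (positive) measure on $\partial\Delta$ defined on each facet $F_i$ by $dL_i\wedge d\sigma=-dx$. For $w\in\mathbb{R}$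 and $f$ affine linear and positive on $\Delta$, the $(f,w)$-Donaldson--Futaki invariant is $$\mathcal{F}_{\Delta,\mathbf{L},f,w}(\phi)=2\int_{\partial\Delta}\frac{\phi}{f^{w-1}}\,d\sigma-\int_\Delta\frac{\phi}{f^{w+1}}\,\zeta_{(\Delta,\mathbf{L},f,w)}\,dx,$$ where $\zeta_{(\Delta,\mathbf{L},f,w)}$ is the unique affine linear function such that $\mathcal{F}_{\Delta,\mathbf{L},f,w}(\phi)=0$ for all affine linear $\phi$. The labelled polytope $(\Delta,\mathbf{L})$ is *$(f,w)$-$K$-stable* if $\mathcal{F}_{\Delta,\mathbf{L},f,w}(\phi)\ge0$ for every convex piecewise affine linear function $\phi$ on $\Delta$ (a maximum of finitely many affine linear functions), with equality if and only if $\phi$ is affine linear. It is *$K$-stable* if this holds with $f\equiv1$ (in which case $w$ is irrelevant). *)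

(* Defs.v *)
From HB Require Import structures.
From mathcomp Require Import all_boot all_order all_algebra.
From mathcomp Require Import all_classical all_reals all_analysis.
From mathcomp Require Import measurable_realfun.

Set Implicit Arguments.
Unset Strict Implicit.
Unset Printing Implicit Defensive.

Import Order.TTheory GRing.Theory Num.Theory.
Import numFieldNormedType.Exports.

Local Open Scope classical_set_scope.
Local Open Scope ring_scope.

Definition rV_display : measure_display.
Proof. exact: default_measure_display. Qed.

(* 'rV[R]_n carries the sigma-algebra generated by the coordinates, which is
   the Borel one. *)
Section measurable_rV.
Variables (R : realType) (n : nat).

Let coord : 'I_n -> 'rV[R]_n -> R := fun i x => x ord0 i.

Let rV_set0 : g_sigma_preimage coord set0.
Proof. exact: sigma_algebra0. Qed.

Let rV_setC A : g_sigma_preimage coord A -> g_sigma_preimage coord (~` A).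
Proof. exact: sigma_algebraC. Qed.

Let rV_bigcup (F : _^nat) : (forall i, g_sigma_preimage coord (F i)) ->
  g_sigma_preimage coord (\bigcup_i (F i)).
Proof. exact: sigma_algebra_bigcup. Qed.

HB.instance Definition _ := @isMeasurable.Build rV_display
  'rV[R]_n (g_sigma_preimage coord) rV_set0 rV_setC rV_bigcup.

End measurable_rV.

Lemma measurable_coord (R : realType) n (i : 'I_n) :
  measurable_fun [set: 'rV[R]_n] (fun x => x ord0 i).
Proof.
move=> _ Y mY; rewrite setTI; apply: sub_sigma_algebra => /=.
rewrite -bigcup_seq/=; exists i => /=; first by rewrite mem_index_enum.
by exists Y => //; rewrite setTI.
Qed.

Lemma measurable_fun_coordP (R : realType) d (T : measurableType d) n
    (f : T -> 'rV[R]_n) :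
  measurable_fun [set: T] f <->
  forall i, measurable_fun [set: T] (fun t => f t ord0 i).
Proof.
split=> [mf i|mf].
  exact: (measurableT_comp (measurable_coord i) mf).
move=> _ A mA; rewrite setTI; move: A mA.
apply: smallest_sub.
  split=> [|A mA|F mF]; rewrite /= ?preimage_set0//.
    rewrite setTD preimage_setC; exact: measurableC.
  rewrite preimage_bigcup; exact: bigcupT_measurable.
move=> A; rewrite -bigcup_seq => -[i /= _ [B mB <-]].
by rewrite setTI; have := mf i measurableT _ mB; rewrite setTI.
Qed.

Definition rV_cons (R : realType) n (p : measurableTypeR R * 'rV[R]_n) :
    'rV[R]_n.+1 :=
  \row_i (if unlift ord0 i is Some j then p.2 ord0 j else p.1).

Fixpoint lebesgue_rV (R : realType) n : set 'rV[R]_n -> \bar R :=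
  match n with
  | 0 => dirac (0 : 'rV[R]_0)
  | n'.+1 => pushforward (lebesgue_measure \x @lebesgue_rV R n')%E
               (@rV_cons R n')
  end.
Arguments lebesgue_rV {R} n.

Definition rV_box (R : realType) n (a b : 'rV[R]_n) : set 'rV[R]_n :=
  [set x | forall i, x ord0 i \in `[a ord0 i, b ord0 i]].

Section lebesgue_rV_measure.
Variable R : realType.

Lemma measurable_rV_cons n : measurable_fun setT (@rV_cons R n).
Proof.
apply/measurable_fun_coordP => i; case: (unliftP ord0 i) => [j|] ->.
  rewrite (_ : (fun t => _) = (fun x : 'rV[R]_n => x ord0 j) \o snd).
    apply: measurableT_comp; [exact: measurable_coord|exact: measurable_snd].
  by apply/funext => t; rewrite mxE liftK.
rewrite (_ : (fun t => _) = fst); first exact: measurable_fst.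
by apply/funext => t; rewrite mxE unlift_none.
Qed.

Lemma measurable_rV_box n (a b : 'rV[R]_n) : measurable (rV_box a b).
Proof.
rewrite (_ : rV_box a b = \bigcap_(i in [set: 'I_n])
    ((fun x : 'rV[R]_n => x ord0 i) @^-1` `[a ord0 i, b ord0 i]%classic)).
  apply: fin_bigcap_measurable => // i _; rewrite -[X in measurable X]setTI.
  exact: measurable_coord.
by apply/seteqP; split=> x /= xab i => [_|]; apply: xab.
Qed.

Lemma rV_cons_box n (a b : 'rV[R]_n.+1) :
  @rV_cons R n @^-1` rV_box a b =
  `[a ord0 ord0, b ord0 ord0]%classic `*` rV_box (col' ord0 a) (col' ord0 b).
Proof.
apply/seteqP; split=> -[t x] /=.
  move=> xab; split=> /= [|i].
    by have := xab ord0; rewrite mxE unlift_none.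
  by rewrite !mxE; have := xab (lift ord0 i); rewrite mxE liftK.
move=> [/= tab xab] i; rewrite mxE; case: unliftP => [j|] ->//.
by have := xab j; rewrite !mxE.
Qed.

Let bigbox n k : set 'rV[R]_n := rV_box (const_mx (- k%:R)) (const_mx k%:R).

Let bigbox_cover n : \bigcup_k @bigbox n k = setT.
Proof.
apply/seteqP; split=> // x _.
exists (\max_(i < n) (Num.truncn `|x ord0 i|).+1)%N => // i.
rewrite in_itv /= !mxE -ler_norml.
apply: (@le_trans _ _ (Num.truncn `|x ord0 i|).+1%:R).
  exact/ltW/truncnS_gt.
by rewrite ler_nat (@leq_bigmax _ (fun i => (Num.truncn `|x ord0 i|).+1)).
Qed.

Let lebesgue_rV_structure n :
  {mu : {sigma_finite_measure set 'rV[R]_n -> \bar R} |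
    mu = @lebesgue_rV R n :> (set 'rV[R]_n -> \bar R)
    & forall a b, (mu (rV_box a b) < +oo)%E}.
Proof.
elim: n => [|n [mu muE muoo]].
  by exists (dirac (0 : 'rV[R]_0)) => // a b; rewrite /= /dirac ltry.
pose nu : {measure set 'rV[R]_n.+1 -> \bar R} :=
  measure_function_pushforward__canonical__measure_function_Measure
    (lebesgue_measure \x mu)%E (@measurable_rV_cons n).
have nuoo a b : (nu (rV_box a b) < +oo)%E.
  rewrite /nu /= /pushforward rV_cons_box product_measure1E//; last first.
    exact: measurable_rV_box.
  rewrite lte_mul_pinfty ?measure_ge0//.
  rewrite ge0_fin_numE//= lebesgue_measure_itv/=; case: ifP => // _.
  by rewrite -EFinB ltry.
have sfnu : sigma_finite setT nu.
  exists (@bigbox n.+1); first by rewrite bigbox_cover.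
  by move=> k; split; [exact: measurable_rV_box|exact: nuoo].
pose snu := Measure_isSigmaFinite.Build _ _ _ nu sfnu.
pose nu' : {sigma_finite_measure set 'rV[R]_n.+1 -> \bar R} :=
  HB.pack (nu : set 'rV[R]_n.+1 -> \bar R) nu snu.
by exists nu' => //=; rewrite -muE.
Qed.

Let lebesgue_rV0 n : @lebesgue_rV R n set0 = 0%E.
Proof. by case: (lebesgue_rV_structure n) => mu <- _; rewrite measure0. Qed.

Let lebesgue_rV_ge0 n (A : set 'rV[R]_n) : (0 <= lebesgue_rV n A)%E.
Proof. by case: (lebesgue_rV_structure n) => mu <- _; rewrite measure_ge0. Qed.

Let lebesgue_rV_sigma_additive n : semi_sigma_additive (@lebesgue_rV R n).
Proof.
case: (lebesgue_rV_structure n) => mu <- _.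
exact: measure_semi_sigma_additive.
Qed.

HB.instance Definition _ n := isMeasure.Build _ _ _ (@lebesgue_rV R n)
  (lebesgue_rV0 n) (@lebesgue_rV_ge0 n) (@lebesgue_rV_sigma_additive n).

Let lebesgue_rV_sigma_finite n : sigma_finite setT (@lebesgue_rV R n).
Proof. by case: (lebesgue_rV_structure n) => mu <- _; exact: sigma_finiteT. Qed.

HB.instance Definition _ n := Measure_isSigmaFinite.Build _ _ _
  (@lebesgue_rV R n) (lebesgue_rV_sigma_finite n).

Lemma lebesgue_rV_box n (a b : 'rV[R]_n) :
  (forall i, a ord0 i <= b ord0 i) ->
  lebesgue_rV n (rV_box a b) = (\prod_(i < n) (b ord0 i - a ord0 i))%:E.
Proof.
elim: n a b => [|n IH] a b ab.
  by rewrite /= big_ord0 diracE mem_set// => -[].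
rewrite [LHS](_ : _ = (lebesgue_measure \x @lebesgue_rV R n)%E
  (@rV_cons R n @^-1` rV_box a b))// rV_cons_box.
rewrite product_measure1E//=; last exact: measurable_rV_box.
rewrite IH; last by move=> i; rewrite !mxE.
rewrite lebesgue_measure_itv/= lte_fin big_ord_recl/= EFinM.
congr (_ * _)%E; last by congr EFin; apply: eq_bigr => i _; rewrite !mxE.
have := ab ord0; rewrite le_eqVlt => /predU1P[->|->]; last by rewrite EFinB.
by rewrite ltxx subrr.
Qed.

End lebesgue_rV_measure.

Record affine (R : realType) (m : nat) :=
  Affine { aff_lin : 'rV[R]_m ; aff_cst : R }.

HB.instance Definition _ R m := gen_eqMixin (affine R m).
HB.instance Definition _ R m := gen_choiceMixin (affine R m).

Definition affine_fun (R : realType) m (l : affine R m) (x : 'rV[R]_m) : R :=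
  \sum_(j < m) aff_lin l ord0 j * x ord0 j + aff_cst l.
Coercion affine_fun : affine >-> Funclass.

Definition affine1 (R : realType) m : affine R m := Affine 0 1.
Arguments affine1 {R m}.

Section polytopes.
Variables (R : realType) (m : nat).
Implicit Types (D F : set 'rV[R]_m) (f l : affine R m).

Definition zero_face D l : set 'rV[R]_m := D `&` [set x | l x = 0].

Definition is_face D F :=
  exists l, (forall x, D x -> 0 <= l x) /\ F = zero_face D l.

(* The affine hull of F is p + <rows of A>, of dimension k. *)
Definition has_affine_dim F k :=
  exists (p : 'rV[R]_m) (A : 'M[R]_(k, m)),
    [/\ F p, forall i, F (p + row i A), row_free A
      & forall x, F x -> (x - p <= A)%MS].

Definition is_facet D F :=
  is_face D F /\ exists2 k, m = k.+1 & has_affine_dim F k.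

Definition is_vertex D v := is_face D [set v].

(* Convexity of D follows from lp_halfspaces. *)
Record labelled_polytope (D : set 'rV[R]_m) d (L : 'I_d -> affine R m) : Prop :=
  LabelledPolytope {
    lp_compact : compact D ;
    lp_interior : interior D !=set0 ;
    lp_halfspaces : D = [set x | forall i, 0 <= L i x] ;
    lp_facets : forall F, is_facet D F <-> exists i, F = zero_face D (L i) ;
    lp_facets_distinct : injective (fun i => zero_face D (L i)) ;
    lp_simple : forall v, is_vertex D v -> #|[pred i | L i v == 0]| = m }.

Definition twist_pt (f : affine R m) (x : 'rV[R]_m) : 'rV[R]_m :=
  (f x)^-1 *: x.

(* The affine function of x / f x equal to l x / f x; note that
   aff_cst f = f 0. See [twist_affE]. *)
Definition twist_aff (f l : affine R m) : affine R m :=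
  let c := aff_cst l / aff_cst f in
  Affine (aff_lin l - c *: aff_lin f) c.

Lemma affine0E l : l 0 = aff_cst l.
Proof. by rewrite /affine_fun big1 ?add0r// => j _; rewrite mxE mulr0. Qed.

Lemma twist_affE f l x : f 0 != 0 -> f x != 0 ->
  twist_aff f l (twist_pt f x) = l x / f x.
Proof.
rewrite affine0E => f0 fx0; apply: (mulIf fx0); rewrite divfK//.
set c := aff_cst l / aff_cst f.
have cE : aff_cst l = c * aff_cst f by rewrite divfK.
rewrite {1}/affine_fun /= -/c mulrDl mulr_suml.
rewrite (eq_bigr (fun j => aff_lin l ord0 j * x ord0 j -
    c * (aff_lin f ord0 j * x ord0 j))); last first.
  by move=> j _; rewrite !mxE -mulrA [_ * f x]mulrC mulVKf// mulrBl mulrA.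
by rewrite sumrB -mulr_sumr /affine_fun mulrDr -cE addrA subrK.
Qed.

Definition twist_set f D := twist_pt f @` D.

Definition twist_labels f d (L : 'I_d -> affine R m) : 'I_d -> affine R m :=
  fun i => twist_aff f (L i).

End polytopes.

Section facet_measure.
Variables (R : realType) (m : nat) (l : affine R m).

(* The hyperplane l = 0 as a graph over the coordinates other than k. *)
Definition hyperplane_chart (k : 'I_m) (y : 'rV[R]_m.-1) : 'rV[R]_m :=
  \row_j (if unlift k j is Some j' then y ord0 j' else
    - (\sum_(i < m.-1) aff_lin l ord0 (lift k i) * y ord0 i + aff_cst l)
      / aff_lin l ord0 k).

Lemma hyperplane_chartP k y : aff_lin l ord0 k != 0 ->
  l (hyperplane_chart k y) = 0.
Proof.
move=> lk0; rewrite /affine_fun (bigD1_ord k)//= mxE unlift_none mulrC divfK//.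
under [X in _ + X + _]eq_bigr do rewrite mxE liftK.
by rewrite -addrA addNr.
Qed.

(* Write a_k for the k-th partial derivative of l. If a_k != 0, then on l = 0 the
   equation dl /\ dsigma = -dx forces dsigma to be, up to sign, the product of
   the dx_j with j != k divided by a_k. Hence the positive measure sigma is
   |a_k|^-1 times Lebesgue measure in the coordinates other than k; the result
   does not depend on the k picked. *)
Definition facet_measure (A : set 'rV[R]_m) : \bar R :=
  if [pick k | aff_lin l ord0 k != 0] is Some k
  then (`|aff_lin l ord0 k|^-1%:E
        * lebesgue_rV m.-1 (hyperplane_chart k @^-1` A))%E
  else 0%E.

Lemma measurable_hyperplane_chart k : measurable_fun setT (hyperplane_chart k).
Proof.
apply/measurable_fun_coordP => j; case: (unliftP k j) => [i|] ->.
  under eq_fun do rewrite mxE liftK.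
  exact: measurable_coord.
under eq_fun do rewrite mxE unlift_none.
apply: measurable_funM => //; apply: measurableT_comp => //.
apply: measurable_funD => //; apply: measurable_sum => i.
by apply: measurable_funM => //; exact: measurable_coord.
Qed.

Let facet_measure0 : facet_measure set0 = 0%E.
Proof.
rewrite /facet_measure; case: pickP => // k _.
by rewrite preimage_set0 measure0 mule0.
Qed.

Let facet_measure_ge0 A : (0 <= facet_measure A)%E.
Proof.
rewrite /facet_measure; case: pickP => // k _.
by rewrite mule_ge0// lee_fin.
Qed.

Let facet_measure_sigma_additive : semi_sigma_additive facet_measure.
Proof.
rewrite /facet_measure; case: pickP => [k _|_]; last first.
  exact: (@measure_semi_sigma_additive _ _ _ mzero).
have r0 : 0 <= `|aff_lin l ord0 k|^-1 by rewrite invr_ge0.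
pose r : {nonneg R} := NngNum r0.
pose mu : {measure set 'rV[R]_m -> \bar R} :=
  measure_function_pushforward__canonical__measure_function_Measure
    (lebesgue_rV m.-1) (@measurable_hyperplane_chart k).
rewrite (_ : (fun A => _) = mscale r mu); last by apply/funext.
exact: measure_semi_sigma_additive.
Qed.

HB.instance Definition _ := isMeasure.Build _ _ _ facet_measure
  facet_measure0 facet_measure_ge0 facet_measure_sigma_additive.

End facet_measure.

Section stability.
Variables (R : realType) (m : nat).
Variables (D : set 'rV[R]_m) (d : nat) (L : 'I_d -> affine R m).

Definition boundary_integral (g : 'rV[R]_m -> R) : R :=
  \sum_(i < d) \int[facet_measure (L i)]_(x in zero_face D (L i)) g x.

Definition DF_wrt (zeta f : affine R m) (w : R) (phi : 'rV[R]_m -> R) : R :=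
  2 * boundary_integral (fun x => phi x / f x `^ (w - 1))
  - \int[lebesgue_rV m]_(x in D) (phi x / f x `^ (w + 1) * zeta x).

(* The zeta for which DF_wrt vanishes on all affine functions; it exists and is
   unique when D is a labelled polytope and f > 0 on D. *)
Definition extremal_affine (f : affine R m) (w : R) : affine R m :=
  xget (Affine 0 0)
    [set zeta | forall l : affine R m, DF_wrt zeta f w l = 0].

Definition donaldson_futaki (f : affine R m) (w : R) (phi : 'rV[R]_m -> R) :=
  DF_wrt (extremal_affine f w) f w phi.

Definition convex_pl (phi : 'rV[R]_m -> R) :=
  exists (l : affine R m) (s : seq (affine R m)),
    forall x, D x -> phi x = \big[Num.max/l x]_(l' <- s) l' x.

Definition affine_on (phi : 'rV[R]_m -> R) :=
  exists l : affine R m, forall x, D x -> phi x = l x.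

Definition fw_K_stable (f : affine R m) (w : R) :=
  forall phi, convex_pl phi ->
    0 <= donaldson_futaki f w phi
    /\ (donaldson_futaki f w phi = 0 <-> affine_on phi).

(* For f = 1 the value of w is irrelevant; see [K_stableE]. *)
Definition K_stable := fw_K_stable affine1 0.

Lemma affine1E x : @affine1 R m x = 1.
Proof.
by rewrite /affine_fun big1 ?add0r// => j _; rewrite mxE mul0r.
Qed.

Lemma K_stableE w : fw_K_stable affine1 w = K_stable.
Proof.
rewrite /K_stable /fw_K_stable /donaldson_futaki.
suff DFE zeta : DF_wrt zeta affine1 w = DF_wrt zeta affine1 0.
  by rewrite /extremal_affine; under eq_set do rewrite DFE; rewrite DFE.
apply/funext => phi; rewrite /DF_wrt /boundary_integral.
congr (_ * _ - _).
  by apply: eq_bigr => i _; apply: eq_Rintegral => x _; rewrite affine1E !powR1.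
by apply: eq_Rintegral => x _; rewrite affine1E !powR1.
Qed.

End stability.

(* Main.v *)
Require Import Defs.
From HB Require Import structures.
From mathcomp Require Import all_boot all_order all_algebra.
From mathcomp Require Import all_classical all_reals all_analysis.
From mathcomp Require Import measurable_realfun.
From mathcomp Require Import ring lra.

Set Implicit Arguments.
Unset Strict Implicit.
Unset Printing Implicit Defensive.

Import Order.TTheory GRing.Theory Num.Theory.
Import numFieldNormedType.Exports.

Local Open Scope classical_set_scope.
Local Open Scope ring_scope.

(** The twist T x = x / f x is the restriction to affine charts of the linear
    map (s, z) |-> (s f(z / s), z) of R^(m+1). Integrating over cones against a
    weight in the height variable turns dx into f^-(m+1) dx, so T carries
    f(0) f^-(m+1) dx to dx. The integral of g over the hyperplane l = 0 is the
    integral over the slab 0 < l <= 1 of the extension of g that is constant in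
    any direction v with dl(v) = 1. Hence linear maps scale facet measures as
    they scale volume, and the cone argument applies to the facets as well:
    T carries f(0) f^-m dsigma to dsigma. For psi (T x) = phi x / f x, with zeta
    twisted likewise, the Donaldson-Futaki functionals of weight m + 2 therefore
    differ by the factor f(0) > 0. Division by f matches convex piecewise affine
    and affine functions on both sides, and since the extremal affine function
    is unique the twist of one is the other. *)

Section measurability_rV.
Context {R : realType} d (T : measurableType d).

Lemma measurable_funV (s : T -> R) :
  measurable_fun setT s -> measurable_fun setT (fun t => (s t)^-1).
Proof.
apply: measurableT_comp; rewrite -(setvU [set 0 : R]).
apply/measurable_funU => //; first exact: measurableC.
split; last exact: measurable_fun_set1.
apply: open_continuous_measurable_fun.
  by apply: closed_openC; exact: closed_eq.
by move=> x /set_mem /eqP x0; exact: inv_continuous.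
Qed.

Lemma measurable_fun_coord n (z : T -> 'rV[R]_n) i :
  measurable_fun setT z -> measurable_fun setT (fun t => z t ord0 i).
Proof. by move=> mz; exact: measurableT_comp (measurable_coord i) mz. Qed.

Lemma measurable_fun_scalev n (s : T -> R) (z : T -> 'rV[R]_n) :
  measurable_fun setT s -> measurable_fun setT z ->
  measurable_fun setT (fun t => s t *: z t).
Proof.
move=> ms mz; apply/measurable_fun_coordP => i; under eq_fun do rewrite mxE.
by apply: measurable_funM => //; exact: measurable_fun_coord.
Qed.

Lemma measurable_fun_addv n (y z : T -> 'rV[R]_n) :
  measurable_fun setT y -> measurable_fun setT z ->
  measurable_fun setT (fun t => y t + z t).
Proof.
move=> my mz; apply/measurable_fun_coordP => i; under eq_fun do rewrite mxE.
by apply: measurable_funD; exact: measurable_fun_coord.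
Qed.

Lemma measurable_fun_col' n (k : 'I_n.+1) (z : T -> 'rV[R]_n.+1) :
  measurable_fun setT z ->
  measurable_fun setT (fun t => col' k (z t) : 'rV[R]_n).
Proof.
move=> mz; apply/measurable_fun_coordP => i; under eq_fun do rewrite mxE.
exact: measurable_fun_coord.
Qed.

End measurability_rV.

Section measurability_affine.
Context {R : realType} {n : nat}.

Lemma measurable_affine (l : affine R n) : measurable_fun setT l.
Proof.
apply: measurable_funD => //; apply: measurable_sum => i.
by apply: measurable_funM => //; exact: measurable_coord.
Qed.

Lemma measurable_zero_face (D : set 'rV[R]_n) l :
  measurable D -> measurable (zero_face D l).
Proof.
move=> mD; apply: measurableI => //.
have /(_ [set 0] (measurable_set1 0)) := measurable_affine l measurableT.
by rewrite setTI.
Qed.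

Lemma measurable_halfspaces d (L : 'I_d -> affine R n) :
  measurable [set x : 'rV[R]_n | forall i, 0 <= L i x].
Proof.
rewrite (_ : [set x | _] = \bigcap_(i in setT) (L i @^-1` `[0, +oo[%classic)).
  apply: fin_bigcap_measurable => // i _; rewrite -[X in measurable X]setTI.
  exact: measurable_affine.
apply/seteqP; split=> x Lx i => [_|]; first by rewrite /= in_itv /= andbT.
by have := Lx i I; rewrite /= in_itv /= andbT.
Qed.

End measurability_affine.

Section coordinate_insertion.
Context {R : realType}.

Definition rV_insert n (k : 'I_n.+1) (t : R) (y : 'rV[R]_n) : 'rV[R]_n.+1 :=
  \row_j (if unlift k j is Some i then y ord0 i else t).

Lemma rV_insert_lift n (k : 'I_n.+1) t y i :
  rV_insert k t y ord0 (lift k i) = y ord0 i.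
Proof. by rewrite mxE liftK. Qed.

Lemma rV_insert_id n (k : 'I_n.+1) t y : rV_insert k t y ord0 k = t.
Proof. by rewrite mxE unlift_none. Qed.

Lemma col'_rV_insert n (k : 'I_n.+1) t y : col' k (rV_insert k t y) = y.
Proof. by apply/rowP => i; rewrite mxE rV_insert_lift. Qed.

Lemma rV_insert_col' n (k : 'I_n.+1) (x : 'rV[R]_n.+1) :
  rV_insert k (x ord0 k) (col' k x) = x.
Proof.
by apply/rowP => i; rewrite !mxE; case: unliftP => [j|] ->; rewrite ?mxE.
Qed.

Lemma rV_insertD n (k : 'I_n.+1) s t y z :
  rV_insert k s y + rV_insert k t z = rV_insert k (s + t) (y + z).
Proof. by apply/rowP => i; rewrite !mxE; case: unliftP => *; rewrite ?mxE. Qed.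

Lemma rV_insertZ n (k : 'I_n.+1) a t y :
  a *: rV_insert k t y = rV_insert k (a * t) (a *: y).
Proof. by apply/rowP => i; rewrite !mxE; case: unliftP => *; rewrite ?mxE. Qed.

Lemma rV_insertC n (k : 'I_n.+1) t u y :
  rV_insert ord0 t (rV_insert k u y) =
  rV_insert (lift ord0 k) u (rV_insert ord0 t y).
Proof.
have lift_ord0 : lift (lift ord0 k) ord0 = ord0 by exact/val_inj.
have lift_lift j : lift ord0 (lift k j) = lift (lift ord0 k) (lift ord0 j).
  by apply/val_inj; rewrite /= /bump !leq0n !add1n ltnS addnS.
apply/rowP => i; case: (unliftP ord0 i) => [j|] ->; last first.
  by rewrite rV_insert_id -{2}lift_ord0 rV_insert_lift rV_insert_id.
rewrite rV_insert_lift; case: (unliftP k j) => [j'|] ->; last first.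
  by rewrite !rV_insert_id.
by rewrite rV_insert_lift lift_lift !rV_insert_lift.
Qed.

Lemma measurable_fun_rV_insert d (T : measurableType d) n (k : 'I_n.+1)
    (t : T -> R) (y : T -> 'rV[R]_n) :
  measurable_fun setT t -> measurable_fun setT y ->
  measurable_fun setT (fun x => rV_insert k (t x) (y x)).
Proof.
move=> mt my; apply/measurable_fun_coordP => i.
case: (unliftP k i) => [j|] ->.
  by under eq_fun do rewrite rV_insert_lift; exact: measurable_fun_coord.
by under eq_fun do rewrite rV_insert_id.
Qed.

End coordinate_insertion.

Section lebesgue_integration.
Context {R : realType}.
Local Notation mR := (measurableTypeR R).
Local Notation lebR := (@lebesgue_measure R).

Lemma lebesgue_measure_affine_preimage (a b : R) (A : set mR) :
  a != 0 -> measurable A ->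
  (lebR A = `|a|%:E * lebR ((fun x => a * x + b)%R @^-1` A))%E.
Proof.
move=> a0 mA; pose phi : mR -> mR := fun x => a * x + b.
have mphi : measurable_fun setT phi.
  by apply: measurable_funD => //; exact: measurable_funM.
pose mu := mscale (NngNum (normr_ge0 a))
  (measure_function_pushforward__canonical__measure_function_Measure lebR mphi).
apply: (@lebesgue_measure_unique _ mu) => // X [[x y] _ <-].
rewrite /= /mscale /= /pushforward.
have [xy|yx] := ltP x y; last first.
  have -> : `]x, y]%classic = set0 :> set R.
    by apply/seteqP; split => z //=; rewrite in_itv /=; lra.
  by rewrite preimage_set0 !measure0 mule0.
have [a_gt0|a_le0] := ltP 0 a.
  have -> : phi @^-1` `]x, y] = `](x - b) / a, (y - b) / a]%classic.
    apply/seteqP; split => z; rewrite /phi /= !in_itv /=;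
      rewrite ltr_pdivrMr// ler_pdivlMr//; lra.
  rewrite !lebesgue_measure_itv/= !lte_fin xy ltr_pM2r ?invr_gt0// ltrD2r xy.
  by rewrite -!EFinB -EFinM gtr0_norm//; congr EFin; field.
have a_lt0 : a < 0 by rewrite lt_neqAle a0.
have -> : phi @^-1` `]x, y] = `[(y - b) / a, (x - b) / a[%classic.
  apply/seteqP; split => z; rewrite /phi /= !in_itv /=;
    rewrite ltr_ndivlMr// ler_ndivrMr//; lra.
rewrite !lebesgue_measure_itv/= !lte_fin xy ltr_nM2r ?invr_lt0// ltrD2r xy.
by rewrite -!EFinB -EFinM ltr0_norm//; congr EFin; field.
Qed.

Lemma integral_affine_subst (a b : R) (g : R -> \bar R) : a != 0 ->
  measurable_fun [set: mR] g -> (forall x, 0 <= g x)%E ->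
  (\int[lebR]_x g x = `|a|%:E * \int[lebR]_x g (a * x + b)%R)%E.
Proof.
move=> a0 mg g0.
have mphi : measurable_fun setT ((fun x => a * x + b) : mR -> mR).
  by apply: measurable_funD => //; exact: measurable_funM.
rewrite (@eq_measure_integral _ _ _ _ (mscale (NngNum (normr_ge0 a))
  (measure_function_pushforward__canonical__measure_function_Measure
    lebR mphi))).
  by rewrite ge0_integral_mscale// ge0_integral_pushforward.
by move=> A mA _; exact: lebesgue_measure_affine_preimage.
Qed.

Let integral_rV_cons n (g : 'rV[R]_n.+1 -> \bar R) :
  measurable_fun setT g -> (forall x, 0 <= g x)%E ->
  (\int[lebesgue_rV n.+1]_x g x =
   \int[lebesgue_rV n]_y \int[lebR]_t g (rV_insert ord0 t y))%E.
Proof.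
move=> mg g0; have mi := @measurable_rV_cons R n.
rewrite (@eq_measure_integral _ _ _ _
  (measure_function_pushforward__canonical__measure_function_Measure
    (lebesgue_measure \x lebesgue_rV n)%E mi)); last by [].
rewrite ge0_integral_pushforward// fubini_tonelli2//=; exact: measurableT_comp.
Qed.

Local Opaque lebesgue_rV.

Lemma measurable_integral_rV_insert n (k : 'I_n.+1)
    (g : 'rV[R]_n.+1 -> \bar R) :
  measurable_fun setT g -> (forall x, 0 <= g x)%E ->
  measurable_fun setT (fun y => \int[lebR]_t g (rV_insert k t y))%E.
Proof.
move=> mg g0; pose h (p : 'rV[R]_n * mR) := g (rV_insert k p.2 p.1).
apply: (@measurable_fun_fubini_tonelli_F _ _ _ _ _ lebR h) => [|p];
  last exact: g0.
apply: (measurableT_comp mg).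
apply: measurable_fun_rV_insert; first exact: measurable_snd.
exact: measurable_fst.
Qed.

Lemma integral_rV_insert n (k : 'I_n.+1) (g : 'rV[R]_n.+1 -> \bar R) :
  measurable_fun setT g -> (forall x, 0 <= g x)%E ->
  (\int[lebesgue_rV n.+1]_x g x =
   \int[lebesgue_rV n]_y \int[lebR]_t g (rV_insert k t y))%E.
Proof.
elim: n k g => [|n IH] k g mg g0; first by rewrite (ord1 k) integral_rV_cons.
case: (unliftP ord0 k) => [k'|] ->; last exact: integral_rV_cons.
pose slice (j : 'I_n.+2) x := (\int[lebR]_t g (rV_insert j t x))%E.
have mslice j : measurable_fun setT (slice j).
  exact: measurable_integral_rV_insert.
have slice_ge0 j x : (0 <= slice j x)%E by exact: integral_ge0.
rewrite (integral_rV_cons mg g0) (IH k' _ (mslice ord0) (slice_ge0 ord0)).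
rewrite [RHS](integral_rV_cons (mslice _) (slice_ge0 _)).
apply: eq_integral => y _.
pose h (p : mR * mR) := g (rV_insert ord0 p.2 (rV_insert k' p.1 y)).
have mh : measurable_fun setT h.
  apply: (measurableT_comp mg).
  apply: measurable_fun_rV_insert; first exact: measurable_snd.
  by apply: measurable_fun_rV_insert => //; exact: measurable_fst.
rewrite (fubini_tonelli h mh (fun p => g0 _)).
by under eq_integral do under eq_integral do rewrite /h rV_insertC.
Qed.

Lemma integral_rV_affine_subst n (a : R) (b : 'rV[R]_n)
    (g : 'rV[R]_n -> \bar R) :
  a != 0 -> measurable_fun setT g -> (forall x, 0 <= g x)%E ->
  (\int[lebesgue_rV n]_x g x =
   (`|a| ^+ n)%:E * \int[lebesgue_rV n]_x g (a *: x + b)%R)%E.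
Proof.
move=> a0; elim: n b g => [|n IH] b g mg g0.
  rewrite expr0 mul1e; apply: eq_integral => x _; congr g.
  by apply/rowP => -[].
pose h (x : 'rV[R]_n.+1) :=
  g (rV_insert ord0 (a * x ord0 ord0 + b ord0 ord0) (col' ord0 x)).
have mh : measurable_fun setT h.
  apply: (measurableT_comp mg); apply: measurable_fun_rV_insert.
    apply: measurable_funD => //; apply: measurable_funM => //.
    exact: measurable_coord.
  exact: measurable_fun_col'.
have h0 x : (0 <= h x)%E by exact: g0.
have hE t y :
    h (rV_insert ord0 t y) = g (rV_insert ord0 (a * t + b ord0 ord0) y).
  by rewrite /h rV_insert_id col'_rV_insert.
pose H (y : 'rV[R]_n) := (\int[lebR]_t h (rV_insert ord0 t y))%E.
have mH : measurable_fun setT H by exact: measurable_integral_rV_insert.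
have H0 y : (0 <= H y)%E by exact: integral_ge0.
have mgab : measurable_fun setT (fun x : 'rV_n.+1 => g (a *: x + b)).
  apply: (measurableT_comp mg); apply: measurable_fun_addv => //.
  exact: measurable_fun_scalev.
rewrite (integral_rV_insert ord0 mg g0) (integral_rV_insert ord0 mgab)//.
transitivity (`|a|%:E * \int[lebesgue_rV n]_y H y)%E.
  rewrite -(ge0_integralZl (lebesgue_rV n) measurableT mH)//.
  apply: eq_integral => y _; rewrite /H.
  under [in RHS]eq_integral do rewrite hE.
  have mgy : measurable_fun setT (fun t : mR => g (rV_insert ord0 t y)).
    by apply: (measurableT_comp mg); exact: measurable_fun_rV_insert.
  exact: (integral_affine_subst _ a0 mgy (fun=> g0 _)).
rewrite (IH (col' ord0 b) H mH H0) muleA -EFinM -exprS; congr (_ * _)%E.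
apply: eq_integral => y _; apply: eq_integral => t _.
by rewrite hE rV_insertZ -[in RHS](rV_insert_col' ord0 b) rV_insertD.
Qed.

End lebesgue_integration.

Local Opaque lebesgue_rV.

Section affine_functions.
Context {R : realType}.
Implicit Types (n : nat) (a : R).

Definition linear_part n (l : affine R n) (x : 'rV[R]_n) : R :=
  \sum_(j < n) aff_lin l ord0 j * x ord0 j.

Lemma linear_part_is_scalar n (l : affine R n) : scalar (linear_part l).
Proof.
move=> a x y; rewrite /linear_part mulr_sumr -big_split /=.
by apply: eq_bigr => j _; rewrite !mxE mulrDr mulrCA.
Qed.

HB.instance Definition _ n (l : affine R n) :=
  GRing.isLinear.Build R 'rV[R]_n R *%R (linear_part l)
    (linear_part_is_scalar l).

Lemma affineE n (l : affine R n) x : l x = linear_part l x + aff_cst l.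
Proof. by []. Qed.

Lemma affineD n (l : affine R n) x v : l (x + v) = l x + linear_part l v.
Proof. by rewrite !affineE linearD addrAC. Qed.

Lemma linear_part_delta n (l : affine R n) k :
  linear_part l (delta_mx ord0 k) = aff_lin l ord0 k.
Proof.
rewrite /linear_part (bigD1 k)//= mxE !eqxx mulr1 big1 ?addr0// => j jk.
by rewrite mxE (negPf jk) andbF mulr0.
Qed.

Lemma linear_part_rV_insert n (l : affine R n.+1) k t y :
  linear_part l (rV_insert k t y) =
  aff_lin l ord0 k * t + linear_part l (rV_insert k 0 y).
Proof.
rewrite /linear_part !(bigD1_ord k)//= !rV_insert_id mulr0 add0r.
by congr (_ + _); apply: eq_bigr => i _; rewrite !rV_insert_lift.
Qed.

Lemma affine_rV_insert n (l : affine R n.+1) k t y :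
  l (rV_insert k t y) = aff_lin l ord0 k * t + l (rV_insert k 0 y).
Proof. by rewrite !affineE linear_part_rV_insert addrA. Qed.

Lemma hyperplane_chart_unique n (l : affine R n.+1) k t y :
  aff_lin l ord0 k != 0 -> l (rV_insert k t y) = 0 ->
  hyperplane_chart l k y = rV_insert k t y.
Proof.
move=> lk /eqP; rewrite affine_rV_insert addr_eq0 => /eqP tE.
apply/rowP => j; rewrite !mxE; case: unliftP => //= _.
apply: (mulIf lk); rewrite divfK// [t * _]mulrC tE; congr (- _).
rewrite /affine_fun (bigD1_ord k)//= rV_insert_id mulr0 add0r.
by congr (_ + _); apply: eq_bigr => i _; rewrite rV_insert_lift.
Qed.

End affine_functions.

Section unit_interval.
Context {R : realType}.

Definition unit_indic (t : measurableTypeR R) : \bar R :=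
  (\1_(`]0, 1]%classic : set R) t)%:E.

Lemma unit_indicE (t : R) :
  unit_indic t = if 0 < t <= 1 then 1%E else 0%E.
Proof. by rewrite /unit_indic indicE mem_setE in_itv /=; case: ifP. Qed.

Lemma measurable_unit_indic : measurable_fun setT unit_indic.
Proof. by apply/measurable_EFinP; exact: measurable_indic. Qed.

Lemma unit_indic_ge0 t : (0 <= unit_indic t)%E.
Proof. by rewrite lee_fin indicE ler0n. Qed.

Lemma integral_unit_indic : (\int[lebesgue_measure]_t unit_indic t = 1)%E.
Proof.
rewrite integral_indic// setIT /= lebesgue_measure_itv/= lte_fin ltr01.
by rewrite oppr0 adde0.
Qed.

End unit_interval.

Section facet_integration.
Context {R : realType}.
Local Notation mR := (measurableTypeR R).
Local Notation lebR := (@lebesgue_measure R).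

(* For [v] transverse to the hyperplane [l = 0], extends [g] from it to the
   slab [0 < l <= 1] as a function constant along [v]. *)
Definition slab_extension m (l : affine R m) (v : 'rV[R]_m)
    (g : 'rV[R]_m -> \bar R) (x : 'rV[R]_m) : \bar R :=
  (unit_indic (l x) * g (x - l x *: v)%R)%E.

Lemma measurable_slab_extension m (l : affine R m) v g :
  measurable_fun setT g -> measurable_fun setT (slab_extension l v g).
Proof.
move=> mg; have ml : measurable_fun setT l by exact: measurable_affine.
apply: emeasurable_funM; first exact: measurableT_comp measurable_unit_indic ml.
apply: (measurableT_comp mg); apply: measurable_fun_addv => //.
under eq_fun do rewrite -scaleNr.
by apply: measurable_fun_scalev => //; exact: measurableT_comp.
Qed.

Lemma slab_extension_ge0 m (l : affine R m) v (g : 'rV[R]_m -> \bar R) x :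
  (forall y, 0 <= g y)%E -> (0 <= slab_extension l v g x)%E.
Proof. by move=> g0; rewrite mule_ge0// unit_indic_ge0. Qed.

Lemma slab_extension_rV_insert n (l : affine R n.+1) k v g t y :
  let a := aff_lin l ord0 k in
  a != 0 -> linear_part l v = 1 ->
  slab_extension l v g (rV_insert k (a^-1 * t - a^-1 * l (rV_insert k 0 y)) y) =
  (unit_indic t * g (hyperplane_chart l k (y - t *: col' k v)))%E.
Proof.
move=> a a0 lv; set x := rV_insert _ _ _.
have lx : l x = t by rewrite affine_rV_insert mulrBr !mulVKf// subrK.
rewrite /slab_extension lx; congr (_ * g _)%E; apply/esym.
have xE :
    x - t *: v = rV_insert k (x ord0 k - t * v ord0 k) (y - t *: col' k v).
  rewrite -[in LHS](rV_insert_col' k v) rV_insertZ -scaleN1r rV_insertZ.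
  by rewrite rV_insertD rV_insert_id mulN1r scaleN1r.
rewrite xE; apply: hyperplane_chart_unique => //.
by rewrite -xE -scaleNr affineD lx linearZ /= lv mulr1 subrr.
Qed.

Let translate_integrand n (u : 'rV[R]_n) (g : 'rV[R]_n -> \bar R)
  (p : 'rV[R]_n * mR) : \bar R := (unit_indic p.2 * g (p.1 - p.2 *: u)%R)%E.

Let measurable_translate_integrand n u (g : 'rV[R]_n -> \bar R) :
  measurable_fun setT g -> measurable_fun setT (translate_integrand u g).
Proof.
move=> mg; apply: emeasurable_funM.
  exact: measurableT_comp measurable_unit_indic measurable_snd.
apply: (measurableT_comp mg); apply: measurable_fun_addv => //.
under eq_fun do rewrite -scaleNr.
by apply: measurable_fun_scalev => //; exact: measurableT_comp measurable_snd.
Qed.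

Let integral_translate n u (g : 'rV[R]_n -> \bar R) :
  measurable_fun setT g -> (forall y, 0 <= g y)%E ->
  (\int[lebesgue_rV n]_y \int[lebR]_t translate_integrand u g (y, t) =
   \int[lebesgue_rV n]_y g y)%E.
Proof.
move=> mg g0; rewrite fubini_tonelli; last 2 first.
- exact: measurable_translate_integrand.
- by move=> p; rewrite mule_ge0// unit_indic_ge0.
transitivity (\int[lebR]_t (unit_indic t * \int[lebesgue_rV n]_y g y))%E.
  apply: eq_integral => t _.
  have mgt : measurable_fun setT (fun y : 'rV[R]_n => g (1 *: y - t *: u)).
    by apply: (measurableT_comp mg); apply: measurable_fun_addv => //;
      exact: measurable_fun_scalev.
  rewrite (integral_rV_affine_subst (- (t *: u)) (oner_neq0 R) mg g0).
  rewrite normr1 expr1n mul1e -(ge0_integralZl (lebesgue_rV n) measurableT mgt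
    (fun _ _ => g0 _) (unit_indic_ge0 t)).
  by apply: eq_integral => y _; rewrite scale1r.
rewrite (ge0_integralZr lebR measurableT measurable_unit_indic
  (fun t _ => unit_indic_ge0 t)); last exact: integral_ge0.
by rewrite integral_unit_indic mul1e.
Qed.

(* Trading the [k]-th coordinate for the value [t] of [l], the slice at [t] is
   the hyperplane [l = 0] translated by [t *: v]. *)
Lemma integral_slab_extension n (l : affine R n.+1) k v
    (g : 'rV[R]_n.+1 -> \bar R) :
  aff_lin l ord0 k != 0 -> linear_part l v = 1 ->
  measurable_fun setT g -> (forall x, 0 <= g x)%E ->
  (\int[lebesgue_rV n.+1]_x slab_extension l v g x =
   `|aff_lin l ord0 k|^-1%:E *
   \int[lebesgue_rV n]_y g (hyperplane_chart l k y))%E.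
Proof.
set a := aff_lin l ord0 k => a0 lv mg g0.
have mE := measurable_slab_extension l v mg.
have E0 x := slab_extension_ge0 l v x g0.
pose gc (y : 'rV[R]_n) := g (hyperplane_chart l k y).
have mgc : measurable_fun setT gc.
  exact: measurableT_comp mg (measurable_hyperplane_chart l k).
have gc0 y : (0 <= gc y)%E by exact: g0.
rewrite (integral_rV_insert k mE E0) -(integral_translate (col' k v) mgc gc0).
have mh := measurable_translate_integrand (col' k v) mgc.
have h0 p : (0 <= translate_integrand (col' k v) gc p)%E.
  by rewrite mule_ge0// unit_indic_ge0.
rewrite -ge0_integralZl//; last 2 first.
- exact: measurable_fun_fubini_tonelli_F.
- by move=> y _; exact: integral_ge0.
apply: eq_integral => y _.
have mEy : measurable_fun setT
    (fun t : mR => slab_extension l v g (rV_insert k t y)).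
  by apply: (measurableT_comp mE); exact: measurable_fun_rV_insert.
rewrite (integral_affine_subst (- (a^-1 * l (rV_insert k 0 y)))
  (invr_neq0 a0) mEy (fun=> E0 _)) normfV.
by under eq_integral do rewrite (slab_extension_rV_insert _ _ _ a0 lv).
Qed.

Lemma integral_facet_measure0 m (l : affine R m) (g : 'rV[R]_m -> \bar R) :
  aff_lin l = 0 -> (\int[facet_measure l]_x g x = 0)%E.
Proof.
move=> l0.
rewrite (@eq_measure_integral _ _ _ _ mzero) ?integral_measure_zero//.
move=> A _ _; rewrite /= /facet_measure; case: pickP => // k.
by rewrite l0 mxE eqxx.
Qed.

(* The right-hand side refers to no coordinate chart. *)
Lemma integral_facet_measure_slab m (l : affine R m) v
    (g : 'rV[R]_m -> \bar R) :
  linear_part l v = 1 -> measurable_fun setT g -> (forall x, 0 <= g x)%E ->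
  (\int[facet_measure l]_x g x =
   \int[lebesgue_rV m]_x slab_extension l v g x)%E.
Proof.
case: m l v g => [|n] l v g lv mg g0.
  by move: lv; rewrite /linear_part big_ord0 => /esym/eqP; rewrite oner_eq0.
case kE : [pick k | aff_lin l ord0 k != 0] => [k|]; last first.
  move: kE lv; case: pickP => // lin0 _; rewrite /linear_part big1 => [|j _].
    by move=> /esym/eqP; rewrite oner_eq0.
  by move/negbFE/eqP: (lin0 j) => ->; rewrite mul0r.
have lk : aff_lin l ord0 k != 0 by move: kE; case: pickP => // j lj [<-].
rewrite (integral_slab_extension lk lv mg g0).
have r0 : 0 <= `|aff_lin l ord0 k|^-1 by rewrite invr_ge0.
have mc := measurable_hyperplane_chart l k.
rewrite (@eq_measure_integral _ _ _ _ (mscale (NngNum r0)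
  (measure_function_pushforward__canonical__measure_function_Measure
    (lebesgue_rV n) mc))).
  by rewrite ge0_integral_mscale// ge0_integral_pushforward.
by move=> A _ _; rewrite /= /facet_measure kE.
Qed.

Lemma integral_facet_measure_chart n (l : affine R n.+1) k
    (g : 'rV[R]_n.+1 -> \bar R) :
  aff_lin l ord0 k != 0 -> measurable_fun setT g -> (forall x, 0 <= g x)%E ->
  (\int[facet_measure l]_x g x =
   `|aff_lin l ord0 k|^-1%:E *
   \int[lebesgue_rV n]_y g (hyperplane_chart l k y))%E.
Proof.
move=> lk mg g0.
pose v : 'rV[R]_n.+1 := (aff_lin l ord0 k)^-1 *: delta_mx ord0 k.
have lv : linear_part l v = 1 by rewrite linearZ /= linear_part_delta mulVf.
rewrite (integral_facet_measure_slab lv mg g0).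
by rewrite (integral_slab_extension lk lv).
Qed.

Lemma integral_facet_measure_comp m (l l' : affine R m) (c : \bar R)
    (A : 'rV[R]_m -> 'rV[R]_m) (g : 'rV[R]_m -> \bar R) :
  linear A -> measurable_fun setT A ->
  (forall h : 'rV[R]_m -> \bar R,
    measurable_fun setT h -> (forall x, 0 <= h x)%E ->
    (\int[lebesgue_rV m]_x h x = c * \int[lebesgue_rV m]_x h (A x))%E) ->
  (forall x, l (A x) = l' x) -> aff_lin l' != 0 ->
  measurable_fun setT g -> (forall x, 0 <= g x)%E ->
  (\int[facet_measure l]_x g x = c * \int[facet_measure l']_x g (A x))%E.
Proof.
move=> linA mA subst_A lA /rV0Pn[k lk] mg g0.
have A0 : A 0 = 0.
  by have := linA (-1) 0 0; rewrite scaler0 addr0 scaleN1r addNr.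
pose v : 'rV[R]_m := (aff_lin l' ord0 k)^-1 *: delta_mx ord0 k.
have lv : linear_part l' v = 1 by rewrite linearZ /= linear_part_delta mulVf.
have lAv : linear_part l (A v) = 1.
  apply: (addrI (l 0)); rewrite -affineD add0r lA -[in RHS]A0 lA.
  by rewrite -[v]add0r affineD lv.
have mgA : measurable_fun setT (g \o A) by exact: measurableT_comp.
rewrite (integral_facet_measure_slab lAv mg g0).
rewrite (integral_facet_measure_slab lv mgA (fun=> g0 _)).
rewrite subst_A; last 2 first.
- exact: measurable_slab_extension.
- by move=> x; exact: slab_extension_ge0.
congr (_ * _)%E; apply: eq_integral => x _; rewrite /slab_extension lA /=.
by congr (_ * g _)%E; rewrite -!scaleNr [in RHS]addrC linA addrC.
Qed.

End facet_integration.

Section cone_integration.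
Context {R : realType}.
Local Notation mR := (measurableTypeR R).
Local Notation lebR := (@lebesgue_measure R).

(* The power [u ^- n] makes [integral_cone_weight] an exact power of [a]. *)
Definition cone_weight n (u : R) : \bar R :=
  ((u ^- n)%:E * unit_indic u)%E.

Lemma cone_weight_ge0 n u : (0 <= cone_weight n u)%E.
Proof.
rewrite /cone_weight unit_indicE; case: ifP => [/andP[u0 _]|_];
  last by rewrite mule0.
by rewrite mule1 lee_fin invr_ge0 exprn_ge0// ltW.
Qed.

Lemma cone_weight_le0 n u : u <= 0 -> cone_weight n u = 0%E.
Proof. by move=> u0; rewrite /cone_weight unit_indicE ltNge u0 mule0. Qed.

Lemma measurable_cone_weight d (T : measurableType d) n (u : T -> R) :
  measurable_fun setT u -> measurable_fun setT (fun t => cone_weight n (u t)).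
Proof.
move=> mu; apply: emeasurable_funM;
  last exact: measurableT_comp measurable_unit_indic mu.
by apply/measurable_EFinP; apply: measurable_funV; exact: measurable_funX.
Qed.

Let cone_weight_integrand n a (s : R) : \bar R :=
  ((`|s| ^+ n)%:E * cone_weight n (s * a)%R)%E.

Let measurable_cone_weight_integrand n a :
  measurable_fun [set: mR] (cone_weight_integrand n a).
Proof.
apply: emeasurable_funM.
  by apply/measurable_EFinP; apply: measurable_funX; exact: normr_measurable.
by apply: measurable_cone_weight; exact: measurable_funM.
Qed.

Let cone_weight_integrand_ge0 n a s : (0 <= cone_weight_integrand n a s)%E.
Proof. by rewrite mule_ge0 ?cone_weight_ge0// lee_fin exprn_ge0. Qed.

Lemma integral_cone_weight n (a : R) : 0 < a ->
  (\int[lebR]_s ((`|s| ^+ n)%:E * cone_weight n (s * a)%R) = (a ^- n.+1)%:E)%E.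
Proof.
move=> a0; have a_neq0 : a != 0 by rewrite gt_eqF.
rewrite (integral_affine_subst 0 (invr_neq0 a_neq0)
  (measurable_cone_weight_integrand n a) (cone_weight_integrand_ge0 n a)).
have an0 : (0 <= (a ^- n)%:E :> \bar R)%E.
  by rewrite lee_fin invr_ge0 exprn_ge0// ltW.
transitivity (`|a^-1|%:E * ((a ^- n)%:E * \int[lebR]_u unit_indic u))%E.
  rewrite -(ge0_integralZl lebR measurableT measurable_unit_indic
    (fun u _ => unit_indic_ge0 u) an0).
  congr (_ * _)%E; apply: eq_integral => u _.
  rewrite /cone_weight_integrand /cone_weight addr0 mulrAC mulVf// mul1r.
  rewrite unit_indicE; case: ifP => [/andP[u0 _]|_]; last by rewrite !mule0.
  rewrite gtr0_norm ?mulr_gt0 ?invr_gt0// !mule1 -EFinM exprMn exprVn.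
  by rewrite mulfK// expf_neq0// gt_eqF.
by rewrite integral_unit_indic mule1 -EFinM gtr0_norm ?invr_gt0// exprS invfM.
Qed.

Definition dehomogenize n (w : 'rV[R]_n.+1) : 'rV[R]_n :=
  (w ord0 ord0)^-1 *: col' ord0 w.

Lemma dehomogenize_rV_insert n s (z : 'rV[R]_n) :
  dehomogenize (rV_insert ord0 s z) = s^-1 *: z.
Proof. by rewrite /dehomogenize rV_insert_id col'_rV_insert. Qed.

(* The degree-0 homogeneous extension of [h] to a cone, weighted by the height
   [s * f (z / s)] at the point [(s, z)]. *)
Definition cone_density e n (f : 'rV[R]_n -> R) (h : 'rV[R]_n -> \bar R)
    (w : 'rV[R]_n.+1) : \bar R :=
  (cone_weight e (w ord0 ord0 * f (dehomogenize w))%R * h (dehomogenize w))%E.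

Lemma measurable_cone_density e n (f : 'rV[R]_n -> R) (h : 'rV[R]_n -> \bar R) :
  measurable_fun setT f -> measurable_fun setT h ->
  measurable_fun setT (cone_density e f h).
Proof.
move=> mf mh; have mhead := @measurable_coord R n.+1 ord0.
have mdehom : measurable_fun setT (@dehomogenize n).
  apply: measurable_fun_scalev; first exact: measurable_funV.
  exact: measurable_fun_col'.
apply: emeasurable_funM; last exact: measurableT_comp.
by apply: measurable_cone_weight; apply: measurable_funM => //;
  exact: measurableT_comp.
Qed.

Lemma cone_density_ge0 e n (f : 'rV[R]_n -> R) (h : 'rV[R]_n -> \bar R) w :
  (forall x, 0 <= h x)%E -> (0 <= cone_density e f h w)%E.
Proof. by move=> h0; rewrite mule_ge0// cone_weight_ge0. Qed.

Lemma cone_density_le0 e n (f : 'rV[R]_n -> R) (h : 'rV[R]_n -> \bar R)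
    (w : 'rV[R]_n.+1) :
  (forall x, h x != 0%E -> 0 < f x) -> w ord0 ord0 <= 0 ->
  cone_density e f h w = 0%E.
Proof.
move=> hf w0; rewrite /cone_density.
have [->|/hf fx] := eqVneq (h (dehomogenize w)) 0%E; first by rewrite mule0.
by rewrite cone_weight_le0 ?mul0e// mulr_le0_ge0// ltW.
Qed.

Section cone_integral.
Variables (n : nat) (f : 'rV[R]_n -> R) (h : 'rV[R]_n -> \bar R).
Hypotheses (mf : measurable_fun setT f) (mh : measurable_fun setT h).
Hypotheses (h0 : forall x, (0 <= h x)%E) (hf : forall x, h x != 0%E -> 0 < f x).

Let polar_integrand (p : 'rV[R]_n * mR) : \bar R :=
  (h p.1 * cone_weight_integrand n (f p.1) p.2)%E.

Let measurable_polar_integrand : measurable_fun setT polar_integrand.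
Proof.
apply: emeasurable_funM; first exact: measurableT_comp measurable_fst.
apply: emeasurable_funM.
  apply/measurable_EFinP; apply: measurable_funX.
  exact: measurableT_comp measurable_snd.
apply: measurable_cone_weight.
apply: measurable_funM; first exact: measurable_snd.
exact: measurableT_comp measurable_fst.
Qed.

Let polar_integrand_ge0 p : (0 <= polar_integrand p)%E.
Proof. by rewrite mule_ge0. Qed.

Let integral_cone_slice (s : R) :
  (\int[lebesgue_rV n]_z cone_density n f h (rV_insert ord0 s z) =
   \int[lebesgue_rV n]_x polar_integrand (x, s))%E.
Proof.
have [s0|s0] := ltP 0 s; last first.
  apply: eq_integral => z _; rewrite cone_density_le0 ?rV_insert_id//.
  rewrite /polar_integrand /=; have [->|/hf fz] := eqVneq (h z) 0%E.
    by rewrite mul0e.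
  rewrite /cone_weight_integrand cone_weight_le0 ?mule0//.
  by rewrite mulr_le0_ge0// ltW.
have mslice : measurable_fun setT
    (fun z : 'rV[R]_n => cone_density n f h (rV_insert ord0 s z)).
  apply: (measurableT_comp (measurable_cone_density n mf mh)).
  exact: measurable_fun_rV_insert.
have s_neq0 : s != 0 by rewrite gt_eqF.
rewrite (integral_rV_affine_subst 0 s_neq0 mslice) => [|z]; last first.
  exact: cone_density_ge0.
have mslice_scaled : measurable_fun setT
    (fun x : 'rV[R]_n => cone_density n f h (rV_insert ord0 s (s *: x + 0))).
  apply: (measurableT_comp mslice); apply: measurable_fun_addv => //.
  exact: measurable_fun_scalev.
rewrite -(ge0_integralZl (lebesgue_rV n) measurableT mslice_scaled) => [|x _|];
  last 2 first.
- exact: cone_density_ge0.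
- by rewrite lee_fin exprn_ge0.
apply: eq_integral => x _.
rewrite /polar_integrand /cone_weight_integrand /cone_density /=.
rewrite dehomogenize_rV_insert rV_insert_id addr0 scalerA mulVf// scale1r.
by rewrite muleA muleC.
Qed.

Lemma integral_cone_density :
  (\int[lebesgue_rV n.+1]_w cone_density n f h w =
   \int[lebesgue_rV n]_x (h x * (f x ^- n.+1)%:E))%E.
Proof.
have mC := measurable_cone_density n mf mh.
have C0 w := cone_density_ge0 n f w h0.
pose slice (p : 'rV[R]_n * mR) := cone_density n f h (rV_insert ord0 p.2 p.1).
have mslice : measurable_fun setT slice.
  apply: (measurableT_comp mC).
  apply: measurable_fun_rV_insert; first exact: measurable_snd.
  exact: measurable_fst.
rewrite (integral_rV_insert ord0 mC C0).
rewrite (fubini_tonelli slice mslice (fun=> C0 _)).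
under eq_integral do rewrite integral_cone_slice.
rewrite -(fubini_tonelli _ measurable_polar_integrand polar_integrand_ge0).
apply: eq_integral => x _; rewrite /polar_integrand /=.
rewrite (ge0_integralZl lebR measurableT
  (measurable_cone_weight_integrand n (f x))
  (fun s _ => cone_weight_integrand_ge0 n (f x) s) (h0 x)).
have [->|/hf fx] := eqVneq (h x) 0%E; first by rewrite !mul0e.
by rewrite integral_cone_weight.
Qed.

End cone_integral.
End cone_integration.

Section homogenization.
Context {R : realType}.

Definition homogenization n (l : affine R n) : affine R n.+1 :=
  Affine (rV_insert ord0 (aff_cst l) (aff_lin l)) 0.

Lemma homogenizationE n (l : affine R n) (w : 'rV[R]_n.+1) :
  homogenization l w = aff_cst l * w ord0 ord0 + linear_part l (col' ord0 w).
Proof.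
rewrite /affine_fun addr0 (bigD1_ord ord0)//= rV_insert_id.
by congr (_ + _); apply: eq_bigr => i _; rewrite rV_insert_lift mxE.
Qed.

Lemma homogenization_dehomogenize n (l : affine R n) (w : 'rV[R]_n.+1) :
  w ord0 ord0 != 0 ->
  homogenization l w = w ord0 ord0 * l (dehomogenize w).
Proof.
move=> w0; rewrite homogenizationE affineE linearZ /= mulrDr mulVKf//.
by rewrite addrC mulrC.
Qed.

Lemma col'_hyperplane_chart n (l : affine R n.+1) k (y : 'rV[R]_n) :
  col' k (hyperplane_chart l k y) = y.
Proof. by apply/rowP => i; rewrite !mxE liftK. Qed.

Lemma hyperplane_chart_head n (l : affine R n.+2) k y :
  hyperplane_chart l (lift ord0 k) y ord0 ord0 = y ord0 ord0.
Proof.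
rewrite -[in LHS](_ : lift (lift ord0 k) ord0 = ord0) ?mxE ?liftK//.
exact/val_inj.
Qed.

Lemma homogenization_hyperplane_chart n (l : affine R n.+1) k
    (w : 'rV[R]_n.+1) :
  aff_lin l ord0 k != 0 -> w ord0 ord0 != 0 ->
  hyperplane_chart (homogenization l) (lift ord0 k) w =
  rV_insert ord0 (w ord0 ord0)
    (w ord0 ord0 *: hyperplane_chart l k (dehomogenize w)).
Proof.
set s := w ord0 ord0 => lk s0; set x := hyperplane_chart l k (dehomogenize w).
have xE : rV_insert ord0 s (s *: x) =
    rV_insert (lift ord0 k) (s * x ord0 k) w.
  rewrite -[in RHS](rV_insert_col' ord0 w) -rV_insertC -/s; congr rV_insert.
  rewrite -{1}(rV_insert_col' k x) rV_insertZ; congr rV_insert.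
  by rewrite col'_hyperplane_chart /dehomogenize scalerA mulfV// scale1r.
rewrite xE; apply: hyperplane_chart_unique; first by rewrite rV_insert_lift.
rewrite -xE homogenization_dehomogenize rV_insert_id// dehomogenize_rV_insert.
by rewrite scalerA mulVf// scale1r hyperplane_chartP ?mulr0.
Qed.

Section facet_cone.
Variables (n : nat) (l : affine R n.+1).
Variables (f : 'rV[R]_n.+1 -> R) (h : 'rV[R]_n.+1 -> \bar R).
Hypotheses (mf : measurable_fun setT f) (mh : measurable_fun setT h).
Hypotheses (h0 : forall x, (0 <= h x)%E) (hf : forall x, h x != 0%E -> 0 < f x).

Let measurable_cone : measurable_fun setT (cone_density n f h).
Proof. exact: measurable_cone_density. Qed.

Let cone_ge0 w : (0 <= cone_density n f h w)%E.
Proof. exact: cone_density_ge0. Qed.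

Let integral_facet_cone_density_cst : aff_lin l = 0 ->
  (\int[facet_measure (homogenization l)]_w cone_density n f h w = 0)%E.
Proof.
move=> l0; have [c0|c0] := eqVneq (aff_cst l) 0.
  apply: integral_facet_measure0; rewrite /= l0 c0.
  by apply/rowP => j; rewrite !mxE; case: unliftP => // i _; rewrite mxE.
have ck : aff_lin (homogenization l) ord0 ord0 != 0 by rewrite rV_insert_id.
rewrite (integral_facet_measure_chart ck measurable_cone cone_ge0).
rewrite integral0_eq ?mule0// => y _; apply: cone_density_le0 => //.
have /eqP := @hyperplane_chartP _ _ (homogenization l) ord0 y ck.
rewrite homogenizationE [linear_part _ _]big1 ?addr0 => [|j _]; last first.
  by rewrite l0 mxE mul0r.
by rewrite mulf_eq0 (negPf c0) /= => /eqP ->.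
Qed.

Lemma integral_facet_cone_density :
  (\int[facet_measure (homogenization l)]_w cone_density n f h w =
   \int[facet_measure l]_x (h x * (f x ^- n.+1)%:E))%E.
Proof.
have [l0|/rV0Pn[k lk]] := eqVneq (aff_lin l) 0.
  by rewrite integral_facet_cone_density_cst// integral_facet_measure0.
have hlk : aff_lin (homogenization l) ord0 (lift ord0 k) != 0.
  by rewrite rV_insert_lift.
have mhf : measurable_fun setT (fun x => h x * (f x ^- n.+1)%:E)%E.
  apply: emeasurable_funM => //; apply/measurable_EFinP.
  by apply: measurable_funV; exact: measurable_funX.
have hf0 x : (0 <= h x * (f x ^- n.+1)%:E)%E.
  have [->|/hf fx] := eqVneq (h x) 0%E; first by rewrite mul0e.
  by rewrite mule_ge0// lee_fin invr_ge0 exprn_ge0// ltW.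
rewrite (integral_facet_measure_chart lk mhf hf0).
rewrite (integral_facet_measure_chart hlk measurable_cone cone_ge0).
rewrite rV_insert_lift.
have mc := measurable_hyperplane_chart l k.
rewrite -(integral_cone_density (f := f \o hyperplane_chart l k)
  (h := h \o hyperplane_chart l k)); last 4 first.
- exact: measurableT_comp.
- exact: measurableT_comp.
- by move=> y; exact: h0.
- by move=> y; exact: hf.
congr (_ * _)%E; apply: eq_integral => w _.
have [w0|w0] := leP (w ord0 ord0) 0.
  rewrite !cone_density_le0//; first by move=> y; exact: hf.
  by rewrite hyperplane_chart_head.
have w_neq0 : w ord0 ord0 != 0 by rewrite gt_eqF.
rewrite homogenization_hyperplane_chart// /cone_density rV_insert_id.
by rewrite dehomogenize_rV_insert scalerA mulVf// scale1r.
Qed.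

End facet_cone.
End homogenization.

Section twist.
Context {R : realType}.
Local Notation mR := (measurableTypeR R).
Implicit Types n : nat.

Definition twist_inv n (f : affine R n) : affine R n := twist_aff f affine1.

Lemma twist_inv_pt n (f : affine R n) x : f 0 != 0 -> f x != 0 ->
  twist_inv f (twist_pt f x) = (f x)^-1.
Proof. by move=> f0 fx; rewrite twist_affE// affine1E div1r. Qed.

Lemma twist_invK n (f : affine R n) x : f 0 != 0 -> f x != 0 ->
  twist_pt (twist_inv f) (twist_pt f x) = x.
Proof.
move=> f0 fx; rewrite {1}/twist_pt twist_inv_pt// invrK.
by rewrite scalerA divff// scale1r.
Qed.

Lemma linear_part_twist_aff n (f l : affine R n) x :
  linear_part (twist_aff f l) x =
  linear_part l x - aff_cst l / aff_cst f * linear_part f x.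
Proof.
rewrite /linear_part mulr_sumr -sumrB; apply: eq_bigr => j _.
by rewrite !mxE mulrBl mulrA.
Qed.

Definition homogeneous_twist n (f : affine R n) (w : 'rV[R]_n.+1) :
    'rV[R]_n.+1 :=
  rV_insert ord0 (homogenization f w) (col' ord0 w).

Lemma homogeneous_twist_is_linear n (f : affine R n) :
  linear (homogeneous_twist f).
Proof.
move=> a w w'; rewrite /homogeneous_twist rV_insertZ rV_insertD.
congr rV_insert.
  by rewrite /= !affineE !addr0 linearP.
by apply/rowP => i; rewrite !mxE.
Qed.

Lemma measurable_homogeneous_twist n (f : affine R n) :
  measurable_fun setT (homogeneous_twist f).
Proof.
apply: measurable_fun_rV_insert; first exact: measurable_affine.
exact: measurable_fun_col'.
Qed.

Lemma homogenization_twist n (f l : affine R n) w : aff_cst f != 0 ->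
  homogenization (twist_aff f l) (homogeneous_twist f w) = homogenization l w.
Proof.
move=> f0; rewrite 2!homogenizationE rV_insert_id col'_rV_insert /=.
rewrite linear_part_twist_aff homogenizationE mulrDr mulrA divfK//.
by rewrite -addrA; congr (_ + _); rewrite addrC subrK.
Qed.

Section change_of_variables.
Variables (n : nat) (f : affine R n).
Hypothesis f0 : aff_cst f != 0.

Lemma integral_homogeneous_twist (g : 'rV[R]_n.+1 -> \bar R) :
  measurable_fun setT g -> (forall w, 0 <= g w)%E ->
  (\int[lebesgue_rV n.+1]_w g w =
   `|aff_cst f|%:E * \int[lebesgue_rV n.+1]_w g (homogeneous_twist f w))%E.
Proof.
move=> mg g0.
have mgA : measurable_fun setT (g \o homogeneous_twist f).
  exact: measurableT_comp mg (measurable_homogeneous_twist f).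
rewrite (integral_rV_insert ord0 mg g0).
rewrite (integral_rV_insert ord0 mgA (fun=> g0 _)).
rewrite -ge0_integralZl//; last 2 first.
- exact: (measurable_integral_rV_insert ord0 mgA (fun=> g0 _)).
- by move=> y _; apply: integral_ge0 => t _; exact: g0.
apply: eq_integral => y _.
have mgy : measurable_fun setT (fun t : mR => g (rV_insert ord0 t y)).
  by apply: (measurableT_comp mg); exact: measurable_fun_rV_insert.
rewrite (integral_affine_subst (linear_part f y) f0 mgy (fun=> g0 _)).
congr (_ * _)%E; apply: eq_integral => t _; congr (g (rV_insert _ _ _)).
  by rewrite homogenizationE rV_insert_id col'_rV_insert.
by rewrite col'_rV_insert.
Qed.

Definition twist_pullback (g : 'rV[R]_n -> \bar R) (x : 'rV[R]_n) : \bar R :=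
  if 0 < f x then g (twist_pt f x) else 0%E.

Lemma measurable_twist_pt : measurable_fun setT (twist_pt f).
Proof.
apply: measurable_fun_scalev => //; apply: measurable_funV.
exact: measurable_affine.
Qed.

Lemma measurable_twist_pullback g :
  measurable_fun setT g -> measurable_fun setT (twist_pullback g).
Proof.
move=> mg; apply: measurable_fun_ifT => //.
  by apply: measurable_fun_ltr => //; exact: measurable_affine.
exact: measurableT_comp mg measurable_twist_pt.
Qed.

Lemma twist_pullback_ge0 (g : 'rV[R]_n -> \bar R) x :
  (forall y, 0 <= g y)%E -> (0 <= twist_pullback g x)%E.
Proof. by rewrite /twist_pullback; case: ifP. Qed.

Lemma twist_pullback_gt0 g x : twist_pullback g x != 0%E -> 0 < f x.
Proof. by rewrite /twist_pullback; case: ifP => //; rewrite eqxx. Qed.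

Lemma cone_density_twist e (g : 'rV[R]_n -> \bar R) w :
  (forall y, g y != 0%E -> 0 < twist_inv f y) ->
  cone_density e (fun=> 1) g (homogeneous_twist f w) =
  cone_density e f (twist_pullback g) w.
Proof.
move=> gf; set s := w ord0 ord0; set u := homogenization f w.
have uE : s != 0 -> u = s * f (dehomogenize w).
  exact: homogenization_dehomogenize.
rewrite {1}/cone_density rV_insert_id mulr1 dehomogenize_rV_insert -/u.
have [/andP[s0 fx]|not_pos] := boolP ((0 < s) && (0 < f (dehomogenize w))).
  rewrite /cone_density -/s -uE ?gt_eqF// /twist_pullback fx; congr (_ * g _)%E.
  by rewrite /twist_pt /dehomogenize -/s scalerA -invfM mulrC uE ?gt_eqF.
have -> : cone_density e f (twist_pullback g) w = 0%E.
  move: not_pos; rewrite negb_and -!leNgt => /orP[s0|fx].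
    by apply: cone_density_le0 => // x; exact: twist_pullback_gt0.
  by rewrite /cone_density /twist_pullback ltNge fx mule0.
have [u0|u0] := leP u 0; first by rewrite cone_weight_le0// mul0e.
have [->|/gf] := eqVneq (g (u^-1 *: col' ord0 w)) 0%E; first by rewrite mule0.
rewrite -dehomogenize_rV_insert -(pmulr_rgt0 _ u0).
have -> : u * twist_inv f (dehomogenize (rV_insert ord0 u (col' ord0 w))) = s.
  rewrite -[u in u * _](rV_insert_id ord0 u (col' ord0 w)).
  rewrite -homogenization_dehomogenize ?rV_insert_id ?gt_eqF//.
  rewrite homogenization_twist// homogenizationE mul1r.
  by rewrite /linear_part big1 ?addr0// => j _; rewrite mxE mul0r.
move=> s0; move: not_pos u0; rewrite s0 uE ?gt_eqF//=.
by rewrite pmulr_rgt0// => /negPf ->.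
Qed.

(* The twist carries [`|f 0| f^-w dmu] to [dnu]. *)
Definition twist_density w (mu nu : {measure set 'rV[R]_n -> \bar R}) :=
  forall g : 'rV[R]_n -> \bar R, measurable_fun setT g ->
    (forall y, 0 <= g y)%E -> (forall y, g y != 0%E -> 0 < twist_inv f y) ->
    (\int[nu]_y g y =
     `|aff_cst f|%:E * \int[mu]_x (twist_pullback g x * (f x ^- w)%:E))%E.

Lemma twist_density_lebesgue_rV :
  twist_density n.+1 (lebesgue_rV n) (lebesgue_rV n).
Proof.
move=> g mg g0 gf.
have measurable_one : measurable_fun [set: 'rV[R]_n] (fun=> 1 : R).
  exact: measurable_cst.
have mf : measurable_fun setT f by exact: measurable_affine.
rewrite -(integral_cone_density mf (measurable_twist_pullback mg)
  (fun x => twist_pullback_ge0 x g0) (@twist_pullback_gt0 g)).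
transitivity (\int[lebesgue_rV n.+1]_w cone_density n (fun=> 1%R) g w)%E.
  rewrite integral_cone_density//; apply: eq_integral => y _.
  by rewrite expr1n invr1 mule1.
rewrite integral_homogeneous_twist; last 2 first.
- exact: measurable_cone_density.
- by move=> w; exact: cone_density_ge0.
by congr (_ * _)%E; apply: eq_integral => w _; exact: cone_density_twist.
Qed.

End change_of_variables.

Lemma twist_density_facet_measure m (f l : affine R m) : aff_cst f != 0 ->
  twist_density f m (facet_measure l) (facet_measure (twist_aff f l)).
Proof.
case: m f l => [|n] f l f0 g mg g0 gf.
  by rewrite !integral_facet_measure0 ?mule0//; apply/rowP => -[].
have [l0|l0] := eqVneq (aff_lin (homogenization l)) 0.
  have lin0 : aff_lin l = 0.
    apply/rowP => i; move/rowP/(_ (lift ord0 i)): l0.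
    by rewrite rV_insert_lift !mxE.
  have cst0 : aff_cst l = 0.
    by move/rowP/(_ ord0): l0; rewrite rV_insert_id mxE.
  rewrite !integral_facet_measure0 ?mule0//=.
  by rewrite lin0 cst0 mul0r scale0r subr0.
have measurable_one : measurable_fun [set: 'rV[R]_n.+1] (fun=> 1 : R).
  exact: measurable_cst.
have mf : measurable_fun setT f by exact: measurable_affine.
rewrite -(integral_facet_cone_density l mf (measurable_twist_pullback f mg)
  (fun x => twist_pullback_ge0 f x g0) (@twist_pullback_gt0 _ f g)).
transitivity (\int[facet_measure (homogenization (twist_aff f l))]_w
    cone_density n (fun=> 1%R) g w)%E.
  rewrite integral_facet_cone_density//; apply: eq_integral => y _.
  by rewrite expr1n invr1 mule1.
rewrite (integral_facet_measure_comp (homogeneous_twist_is_linear f)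
  (measurable_homogeneous_twist f) (integral_homogeneous_twist f0)
  (fun w => homogenization_twist l w f0) l0); last 2 first.
- exact: measurable_cone_density.
- by move=> w; exact: cone_density_ge0.
by congr (_ * _)%E; apply: eq_integral => w _; exact: cone_density_twist.
Qed.

End twist.

Section twist_involution.
Context {R : realType} {n : nat}.
Implicit Type f : affine R n.

Lemma aff_cst_twist_inv_neq0 f : aff_cst f != 0 -> aff_cst (twist_inv f) != 0.
Proof. by move=> f0; rewrite /= mul1r invr_neq0. Qed.

Lemma twist_inv_inv f : aff_cst f != 0 -> twist_inv (twist_inv f) = f.
Proof.
case: f => a c c0; rewrite /twist_inv /twist_aff /= !mul1r invrK.
by rewrite !sub0r scalerN opprK scalerA divff// scale1r.
Qed.

Lemma twist_affK f : aff_cst f != 0 ->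
  cancel (twist_aff f) (twist_aff (twist_inv f)).
Proof.
move=> f0 [a c]; rewrite /twist_inv /twist_aff /= !mul1r invrK divfK//.
by rewrite sub0r scalerN opprK scalerA subrK.
Qed.

Lemma twist_aff_invK f : aff_cst f != 0 ->
  cancel (twist_aff (twist_inv f)) (twist_aff f).
Proof.
move=> f0; rewrite -{2}(twist_inv_inv f0); apply: twist_affK.
exact: aff_cst_twist_inv_neq0.
Qed.

End twist_involution.

Lemma fine_mulBr (R : realType) (c : R) (a b : \bar R) :
  0 < c -> (0 <= a)%E -> (0 <= b)%E ->
  fine (c%:E * a - c%:E * b)%E = c * fine (a - b)%E.
Proof.
move=> c0; case: a => [a| |]//; case: b => [b| |]// _ _ /=.
  exact/esym/mulrBr.
all: by rewrite gt0_muley ?lte_fin//= mulr0.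
Qed.

Section twist_set.
Context {R : realType} {m : nat}.
Variables (D : set 'rV[R]_m) (f : affine R m).
Hypotheses (f0 : aff_cst f != 0) (fD : forall x, D x -> 0 < f x).

Let f00 : f 0 != 0. Proof. by rewrite affine0E. Qed.

Lemma twist_inv_gt0 y : twist_set f D y -> 0 < twist_inv f y.
Proof.
by move=> [x /fD fx <-]; rewrite twist_inv_pt ?invr_gt0// gt_eqF.
Qed.

Lemma twist_setK : twist_set (twist_inv f) (twist_set f D) = D.
Proof.
apply/seteqP; split=> [_ [_ [x Dx <-] <-]|x Dx].
  by rewrite twist_invK// gt_eqF// fD.
by exists (twist_pt f x); [exists x|rewrite twist_invK// gt_eqF// fD].
Qed.

Lemma twist_setP y : twist_set f D y <->
  0 < twist_inv f y /\ D (twist_pt (twist_inv f) y).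
Proof.
split=> [Ty|[fy Dy]].
  split; first exact: twist_inv_gt0.
  by case: Ty => x Dx <-; rewrite twist_invK// gt_eqF// fD.
exists (twist_pt (twist_inv f) y) => //.
have := @twist_invK _ _ (twist_inv f) y; rewrite twist_inv_inv// affine0E.
by apply; rewrite ?aff_cst_twist_inv_neq0// gt_eqF.
Qed.

Lemma twist_set_pt x : 0 < f x -> twist_set f D (twist_pt f x) <-> D x.
Proof.
move=> fx; have fx0 : f x != 0 by rewrite gt_eqF.
by rewrite twist_setP twist_inv_pt// twist_invK// invr_gt0; split=> [[]|].
Qed.

Lemma measurable_twist_set : measurable D -> measurable (twist_set f D).
Proof.
move=> mD.
have -> : twist_set f D = [set y | 0 < twist_inv f y] `&`
    (twist_pt (twist_inv f) @^-1` D).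
  by apply/seteqP; split => y /twist_setP.
apply: measurableI; last first.
  by rewrite -[X in measurable X]setTI; exact: measurable_twist_pt.
have -> : [set y | 0 < twist_inv f y] = twist_inv f @^-1` `]0, +oo[%classic.
  by apply/seteqP; split => y /=; rewrite in_itv /= andbT.
rewrite -[X in measurable X]setTI.
exact: measurable_affine.
Qed.

Lemma zero_face_twist l :
  zero_face (twist_set f D) (twist_aff f l) = twist_set f (zero_face D l).
Proof.
have lE x : D x -> (twist_aff f l (twist_pt f x) == 0) = (l x == 0).
  move=> /fD fx; have fx0 : f x != 0 by rewrite gt_eqF.
  by rewrite twist_affE// mulf_eq0 invr_eq0 (negPf fx0) orbF.
apply/seteqP; split=> [_ [[x Dx <-] /eqP]|_ [x [Dx /eqP lx] <-]].
  by rewrite lE// => /eqP lx; exists x.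
by split; [exists x|apply/eqP; rewrite lE].
Qed.

Definition is_twist (phi psi : 'rV[R]_m -> R) :=
  forall x, D x -> psi (twist_pt f x) = phi x / f x.

Lemma is_twist_affine (l : affine R m) : is_twist l (twist_aff f l).
Proof. by move=> x /fD fx; rewrite twist_affE// gt_eqF. Qed.

Lemma is_twist_pull psi : is_twist (fun x => psi (twist_pt f x) * f x) psi.
Proof. by move=> x /fD fx; rewrite mulfK// gt_eqF. Qed.

Lemma is_twist_push phi :
  is_twist phi (fun y => phi (twist_pt (twist_inv f) y) * twist_inv f y).
Proof. by move=> x /fD fx; rewrite twist_invK ?twist_inv_pt// gt_eqF. Qed.

Lemma ge0_integral_twist_set w (mu nu : {measure set 'rV[R]_m -> \bar R})
    (g : 'rV[R]_m -> \bar R) :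
  twist_density f w mu nu -> measurable D ->
  measurable_fun (twist_set f D) g -> (forall y, 0 <= g y)%E ->
  (\int[nu]_(y in twist_set f D) g y = `|aff_cst f|%:E *
   \int[mu]_(x in D) (g (twist_pt f x) * (f x ^- w)%:E))%E.
Proof.
move=> munu mD mg g0; rewrite integral_mkcond munu; last 3 first.
- exact/(measurable_restrictT _ (measurable_twist_set mD)).
- by move=> y; rewrite patchE; case: ifP.
- move=> y; rewrite patchE; case: ifPn => [/set_mem/twist_inv_gt0//|].
  by rewrite eqxx.
congr (_ * _)%E; rewrite [RHS]integral_mkcond; apply: eq_integral => x _.
rewrite /twist_pullback !patchE; have [fx|fx] := boolP (0 < f x); last first.
  by rewrite mul0e ifN//; apply: contra fx => /set_mem /fD.
have -> : (twist_pt f x \in twist_set f D) = (x \in D).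
  by apply/idP/idP => /set_mem/(twist_set_pt fx)/mem_set.
by case: ifP => //; rewrite mul0e.
Qed.

Lemma Rintegral_twist_set w (mu nu : {measure set 'rV[R]_m -> \bar R})
    (g : 'rV[R]_m -> R) :
  twist_density f w mu nu -> measurable D -> measurable_fun (twist_set f D) g ->
  \int[nu]_(y in twist_set f D) g y =
  `|aff_cst f| * \int[mu]_(x in D) (g (twist_pt f x) / f x ^+ w).
Proof.
move=> munu mD mg; rewrite /Rintegral.
have mG : measurable_fun (twist_set f D) (EFin \o g) by exact/measurable_EFinP.
have fw0 x : D x -> 0 <= f x ^- w.
  by move=> /fD/ltW fx; rewrite invr_ge0 exprn_ge0.
rewrite integralE [in RHS]integralE.
rewrite (ge0_integral_twist_set munu)//; last exact: measurable_funepos.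
rewrite (ge0_integral_twist_set munu)//; last exact: measurable_funeneg.
rewrite fine_mulBr ?normr_gt0//; last 2 first.
- by apply: integral_ge0 => x /fw0 fx; rewrite mule_ge0.
- by apply: integral_ge0 => x /fw0 fx; rewrite mule_ge0.
congr (_ * fine (_ - _)%E); apply: eq_integral => x /set_mem /fw0 fx.
  rewrite !funeposE /= -!EFin_max -EFinM; congr EFin.
  by rewrite maxr_pMl// mul0r.
rewrite !funenegE /= -!EFin_max -EFinM; congr EFin.
by rewrite maxr_pMl// mul0r mulNr.
Qed.

End twist_set.

Lemma is_twist_inv (R : realType) m (D : set 'rV[R]_m) (f : affine R m)
    phi psi :
  aff_cst f != 0 -> (forall x, D x -> 0 < f x) ->
  is_twist D f phi psi -> is_twist (twist_set f D) (twist_inv f) psi phi.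
Proof.
move=> f0 fD psiE _ [x Dx <-]; have fx : f x != 0 by rewrite gt_eqF// fD.
by rewrite twist_invK ?twist_inv_pt ?affine0E// psiE// invrK divfK.
Qed.

Lemma twist_invariant (R : realType) m
    (P : set 'rV[R]_m -> ('rV[R]_m -> R) -> Prop) :
  (forall D (f : affine R m) phi psi, aff_cst f != 0 ->
    (forall x, D x -> 0 < f x) -> is_twist D f phi psi ->
    P D phi -> P (twist_set f D) psi) ->
  forall D (f : affine R m) phi psi, aff_cst f != 0 ->
    (forall x, D x -> 0 < f x) -> is_twist D f phi psi ->
    P (twist_set f D) psi <-> P D phi.
Proof.
move=> twistP D f phi psi f0 fD psiE; split; last exact: twistP.
rewrite -{2}(twist_setK f0 fD); apply: twistP.
- exact: aff_cst_twist_inv_neq0.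
- exact: twist_inv_gt0.
- exact: is_twist_inv.
Qed.

Section donaldson_futaki_twist.
Context {R : realType} {m d : nat}.
Implicit Types (D : set 'rV[R]_m) (L : 'I_d -> affine R m) (zeta : affine R m).

Lemma eq_boundary_integral D L (g h : 'rV[R]_m -> R) :
  (forall x, D x -> g x = h x) ->
  boundary_integral D L g = boundary_integral D L h.
Proof.
by move=> gh; apply: eq_bigr => i _; apply: eq_Rintegral => x /set_mem[/gh].
Qed.

Lemma DF_wrt_affine1 D L zeta w psi : DF_wrt D L zeta affine1 w psi =
  2 * boundary_integral D L psi - \int[lebesgue_rV m]_(x in D) (psi x * zeta x).
Proof.
rewrite /DF_wrt; congr (2 * _ - _).
  by apply: eq_boundary_integral => x _; rewrite affine1E powR1 divr1.
by apply: eq_Rintegral => x _; rewrite affine1E powR1 divr1.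
Qed.

Variables (D : set 'rV[R]_m) (L : 'I_d -> affine R m) (f : affine R m).
Hypotheses (f0 : 0 < aff_cst f) (fD : forall x, D x -> 0 < f x).
Hypothesis mD : measurable D.

Let f_neq0 : aff_cst f != 0. Proof. by rewrite gt_eqF. Qed.

Lemma boundary_integral_twist (psi : 'rV[R]_m -> R) :
  measurable_fun (twist_set f D) psi ->
  boundary_integral (twist_set f D) (twist_labels f L) psi =
  aff_cst f * boundary_integral D L (fun x => psi (twist_pt f x) / f x ^+ m).
Proof.
move=> mpsi; rewrite /boundary_integral mulr_sumr; apply: eq_bigr => i _.
rewrite /twist_labels zero_face_twist// -(gtr0_norm f0).
apply: Rintegral_twist_set => //.
- by move=> x [/fD].
- exact: twist_density_facet_measure.
- exact: measurable_zero_face.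
- rewrite -zero_face_twist//; apply: measurable_funS mpsi; last by move=> y [].
  exact: measurable_twist_set.
Qed.

Lemma DF_wrt_twist zeta (phi psi : 'rV[R]_m -> R) :
  measurable_fun (twist_set f D) psi -> is_twist D f phi psi ->
  DF_wrt (twist_set f D) (twist_labels f L) (twist_aff f zeta) affine1 0 psi =
  aff_cst f * DF_wrt D L zeta f (m + 2)%:R phi.
Proof.
move=> mpsi psiE; rewrite DF_wrt_affine1 /DF_wrt mulrBr [in RHS]mulrCA.
have powE x k : D x -> f x `^ k%:R = f x ^+ k.
  by move=> /fD /ltW fx; rewrite powR_mulrn.
congr (2 * _ - _).
  rewrite boundary_integral_twist//; congr (_ * _).
  apply: eq_boundary_integral => x Dx; rewrite psiE// addn2 -natr1 addrK powE//.
  by rewrite exprS invfM mulrA.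
rewrite -(gtr0_norm f0).
rewrite (Rintegral_twist_set _ _ (w := m.+1) (mu := lebesgue_rV m))//.
- congr (_ * _); apply: eq_Rintegral => x /set_mem Dx.
  have fx : f x != 0 by rewrite gt_eqF// fD.
  rewrite psiE// twist_affE ?affine0E// natr1 powE// addn2 !exprS.
  by field; rewrite expf_neq0.
- exact: twist_density_lebesgue_rV.
- apply: measurable_funM => //; apply: measurable_funTS.
  exact: measurable_affine.
Qed.

End donaldson_futaki_twist.

Section lebesgue_rV_topology.
Context {R : realType} {m : nat}.
Implicit Types (D U : set 'rV[R]_m) (p : 'rV[R]_m) (g : 'rV[R]_m -> R).

Lemma continuous_affine (l : affine R m) : continuous (l : 'rV[R]_m -> R).
Proof.
move=> x; apply: continuousD; last exact: cst_continuous.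
apply: continuous_big => [|j _ y]; first exact: add_continuous.
by apply: continuousM; [exact: cst_continuous|exact: coord_continuous].
Qed.

Lemma compact_continuous_bounded D g : compact D -> {in D, continuous g} ->
  [bounded g x | x in D].
Proof.
move=> cD cg; have /compact_bounded[M [Mreal gM]] : compact (g @` D).
  by apply: continuous_compact => //; exact: continuous_in_subspaceT.
by exists M; split=> // K /gM gK x Dx; apply: gK; exists x.
Qed.

Lemma compact_lebesgue_rV_lty D :
  measurable D -> compact D -> (lebesgue_rV m D < +oo)%E.
Proof.
move=> mD /compact_bounded[M [Mreal DM]].
pose r := Num.max M 0 + 1.
have r0 : 0 < r by rewrite ltr_wpDl// le_max lexx orbT.
have Mr : M < r by rewrite ltr_pwDr// le_max lexx.
apply: (@le_lt_trans _ _
    (lebesgue_rV m (rV_box (const_mx (- r)) (const_mx r)))).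
  apply: le_measure; rewrite ?inE//; first exact: measurable_rV_box.
  move=> x /(DM _ Mr) xr i; rewrite in_itv /= !mxE -ler_norml.
  apply: le_trans (xr : mx_norm x <= r); rewrite mx_normrE.
  exact: (le_bigmax _ (fun ij => `|x ij.1 ij.2|) (ord0, i)).
rewrite lebesgue_rV_box ?ltry// => i; rewrite !mxE.
by lra.
Qed.

Lemma integrable_compact_continuous D g :
  measurable D -> compact D -> measurable_fun D g -> {in D, continuous g} ->
  (lebesgue_rV m).-integrable D (EFin \o g).
Proof.
move=> mD cD mg cg; apply: measurable_bounded_integrable => //.
  exact: compact_lebesgue_rV_lty.
exact: compact_continuous_bounded.
Qed.

Lemma nbhs_rV_box p U : nbhs p U ->
  exists2 e, 0 < e & rV_box (p - const_mx e) (p + const_mx e) `<=` U.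
Proof.
move=> /nbhs_ballP[e /= e0 eU]; exists (e / 2); first by rewrite divr_gt0.
move=> x xp; apply: eU; split => // i j; rewrite (ord1 i) /ball /= distrC.
have := xp j; rewrite in_itv /= !mxE ltr_norml => /andP[]; lra.
Qed.

Lemma lebesgue_rV_nbhs_gt0 p U :
  measurable U -> nbhs p U -> (0 < lebesgue_rV m U)%E.
Proof.
move=> mU /nbhs_rV_box[e e0 eU].
apply: (@lt_le_trans _ _
    (lebesgue_rV m (rV_box (p - const_mx e) (p + const_mx e)))); last first.
  by apply: le_measure; rewrite ?inE//; exact: measurable_rV_box.
rewrite lebesgue_rV_box => [|i]; last by rewrite !mxE; lra.
by rewrite lte_fin prodr_gt0// => i _; rewrite !mxE; lra.
Qed.

Lemma integral_eq0_interior D g p :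
  measurable D -> measurable_fun D g -> (forall x, D x -> 0 <= g x) ->
  (\int[lebesgue_rV m]_(x in D) (g x)%:E = 0)%E ->
  interior D p -> {for p, continuous g} -> g p = 0.
Proof.
move=> mD mg g0 intg0 Dp cg; apply/eqP/negPn/negP => gp.
have [N [mN N0 gN]] : ae_eq (lebesgue_rV m) D (EFin \o g) (cst 0%E).
  apply/ae_eq_integral_abs => //; first exact/measurable_EFinP.
  rewrite -intg0; apply: eq_integral => x /set_mem Dx.
  by rewrite gee0_abs// lee_fin g0.
suff : (0 < lebesgue_rV m N)%E by rewrite N0 ltxx.
apply: (@lebesgue_rV_nbhs_gt0 p) => //.
have g_neq0 : nbhs p (g @^-1` [set t | t != 0]).
  by apply: cg; apply: open_nbhs_nbhs; split => //; exact: open_neq.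
apply: filterS (filterI Dp g_neq0) => x [Dx gx]; apply: gN => /= /(_ Dx) [].
exact/eqP.
Qed.

Lemma affine_nbhs_inj (l l' : affine R m) p :
  (\forall x \near p, l x = l' x) -> l = l'.
Proof.
move=> /nbhs_rV_box[e e0 ll'].
have ll'p : l p = l' p by apply: ll' => i; rewrite in_itv /= !mxE; lra.
have linE : aff_lin l = aff_lin l'.
  apply/rowP => j; apply: (mulfI (lt0r_neq0 e0)); apply: (addrI (l p)).
  have : l (p + e *: delta_mx ord0 j) = l' (p + e *: delta_mx ord0 j).
    apply: ll' => i; rewrite in_itv /= !mxE eqxx /=.
    by case: eqP => _ /=; lra.
  by rewrite !affineD !linearZ /= !linear_part_delta ll'p.
move: ll'p; rewrite !affineE /linear_part linE => /addrI.
by case: l l' linE {ll'} => a c [a' c'] /= -> ->.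
Qed.

End lebesgue_rV_topology.

Section extremal_affine_uniqueness.
Context {R : realType} {m : nat}.
Variables (D : set 'rV[R]_m) (f : affine R m).
Hypotheses (cD : compact D) (mD : measurable D) (fD : forall x, D x -> 0 < f x).

Let weighted (w : R) (a b : affine R m) x := a x / f x `^ w * b x.

Let measurable_weighted w a b : measurable_fun setT (weighted w a b).
Proof.
apply: measurable_funM; last exact: measurable_affine.
apply: measurable_funM; first exact: measurable_affine.
apply: measurable_funV.
exact: measurableT_comp (measurable_powR w) (measurable_affine f).
Qed.

Let continuous_weighted w a b : {in D, continuous (weighted w a b)}.
Proof.
move=> x /set_mem/fD fx.
have cf : {for x, continuous (fun y => f y `^ w)}.
  apply: (@continuous_comp _ _ _ (f : 'rV[R]_m -> R) (fun t => t `^ w)).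
    exact: continuous_affine.
  apply/differentiable_continuous/derivable1_diffP/derivable_powR.
  by rewrite in_itv /= fx.
apply: (@continuousM R _ (fun y => a y / f y `^ w) b).
  apply: (@continuousM R _ a (fun y => (f y `^ w)^-1)).
    exact: continuous_affine.
  by apply: continuousV => //; rewrite gt_eqF// powR_gt0.
exact: continuous_affine.
Qed.

Let integrable_weighted w a b :
  (lebesgue_rV m).-integrable D (EFin \o weighted w a b).
Proof.
by apply: integrable_compact_continuous => //; exact: measurable_funTS.
Qed.

Lemma extremal_affine_unique d (L : 'I_d -> affine R m) (w : R)
    (zeta zeta' : affine R m) :
  interior D !=set0 ->
  (forall l : affine R m, DF_wrt D L zeta f w l = 0) ->
  (forall l : affine R m, DF_wrt D L zeta' f w l = 0) -> zeta = zeta'.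
Proof.
move=> [p Dp] DF0 DF0'.
pose l := Affine (aff_lin zeta - aff_lin zeta') (aff_cst zeta - aff_cst zeta').
have lE x : l x = zeta x - zeta' x.
  rewrite /affine_fun /= opprD addrACA -sumrB; congr (_ + _).
  by apply: eq_bigr => j _; rewrite !mxE mulrBl.
have int_l : \int[lebesgue_rV m]_(x in D) weighted (w + 1) l l x = 0.
  transitivity (\int[lebesgue_rV m]_(x in D) weighted (w + 1) l zeta x -
      \int[lebesgue_rV m]_(x in D) weighted (w + 1) l zeta' x).
    rewrite -RintegralB//; apply: eq_Rintegral => x _.
    by rewrite /weighted -mulrBr -lE.
  by rewrite -(subr0_eq (DF0 l)) -(subr0_eq (DF0' l)) subrr.
apply: (@affine_nbhs_inj _ _ _ _ p).
apply: filterS (nbhs_interior Dp) => x Dx; apply/eqP; rewrite -subr_eq0 -lE.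
have fx : 0 < f x by exact: fD (nbhs_singleton Dx).
suff : weighted (w + 1) l l x == 0.
  by rewrite /weighted !mulf_eq0 invr_eq0 (gt_eqF (powR_gt0 _ fx)) orbF orbb.
apply/eqP/(integral_eq0_interior mD _ _ _ Dx).
- exact: measurable_funTS.
- move=> y /fD fy; rewrite /weighted mulrAC -expr2 divr_ge0 ?sqr_ge0//.
  exact: powR_ge0.
- rewrite -[LHS]fineK; last first.
    by apply: integrable_fin_num => //; exact: integrable_weighted.
  by congr EFin.
- by apply: continuous_weighted; exact: mem_set (nbhs_singleton Dx).
Qed.

End extremal_affine_uniqueness.

Section convex_pl_twist.
Context {R : realType} {m : nat}.
Implicit Types (D : set 'rV[R]_m) (f l : affine R m) (phi psi : 'rV[R]_m -> R).

Lemma bigmax_twist_aff f l (s : seq (affine R m)) x : f 0 != 0 -> 0 < f x ->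
  \big[Num.max/twist_aff f l (twist_pt f x)]_(k <- map (twist_aff f) s)
    k (twist_pt f x) = (\big[Num.max/l x]_(k <- s) k x) / f x.
Proof.
move=> f0 fx; have fx_neq0 : f x != 0 by rewrite gt_eqF.
elim: s => [|k s IH]; first by rewrite /= !big_nil twist_affE.
by rewrite /= !big_cons IH maxr_pMl ?invr_ge0 ?ltW// twist_affE.
Qed.

Lemma convex_pl_twist D f phi psi :
  aff_cst f != 0 -> (forall x, D x -> 0 < f x) -> is_twist D f phi psi ->
  convex_pl (twist_set f D) psi <-> convex_pl D phi.
Proof.
apply: twist_invariant => {}D {}f {}phi {}psi f0 fD psiE [l [s phiE]].
exists (twist_aff f l), (map (twist_aff f) s) => _ [x Dx <-].
by rewrite bigmax_twist_aff ?affine0E ?fD// psiE// phiE.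
Qed.

Lemma affine_on_twist D f phi psi :
  aff_cst f != 0 -> (forall x, D x -> 0 < f x) -> is_twist D f phi psi ->
  affine_on (twist_set f D) psi <-> affine_on D phi.
Proof.
apply: twist_invariant => {}D {}f {}phi {}psi f0 fD psiE [l phiE].
exists (twist_aff f l) => _ [x Dx <-].
by rewrite psiE// phiE// twist_affE ?affine0E// gt_eqF// fD.
Qed.

Lemma measurable_convex_pl D phi :
  measurable D -> convex_pl D phi -> measurable_fun D phi.
Proof.
move=> mD [l [s phiE]].
apply: (eq_measurable_fun (fun x => \big[Num.max/l x]_(k <- s) k x)).
  by move=> x /set_mem /phiE.
apply: measurable_funTS; elim: s {phiE} => [|k s IH].
  by under eq_fun do rewrite big_nil; exact: measurable_affine.
under eq_fun do rewrite big_cons.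
by apply: measurable_maxr => //; exact: measurable_affine.
Qed.

End convex_pl_twist.

Lemma xget_preimage (T T' : choiceType) (h : T -> T') (h' : T' -> T) x0
    (P : set T') :
  cancel h' h -> is_subset1 (h @^-1` P) ->
  xget (h x0) P = h (xget x0 (h @^-1` P)).
Proof.
move=> h'K P_subset1; have [[x Px]|nP] := pselect (exists x, P (h x)).
  rewrite (xget_subset1 x0 Px P_subset1); apply: xget_unique => // y.
  by rewrite -(h'K y) => Py; congr h; exact: P_subset1.
rewrite !xgetPN//; first by move=> x Px; apply: nP; exists x.
by move=> y; rewrite -(h'K y) => Py; apply: nP; exists (h' y).
Qed.

Section stability_twist.
Context {R : realType} {m d : nat}.
Variables (D : set 'rV[R]_m) (L : 'I_d -> affine R m) (f : affine R m).
Hypotheses (f0 : 0 < aff_cst f) (fD : forall x, D x -> 0 < f x).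
Hypotheses (cD : compact D) (iD : interior D !=set0) (mD : measurable D).

Let f_neq0 : aff_cst f != 0. Proof. by rewrite gt_eqF. Qed.

Local Notation TD := (twist_set f D).
Local Notation TL := (twist_labels f L).

Lemma extremal_affine_twist :
  extremal_affine TD TL affine1 0 =
  twist_aff f (extremal_affine D L f (m + 2)%:R).
Proof.
pose P : set (affine R m) :=
  [set zeta | forall l : affine R m, DF_wrt TD TL zeta affine1 0 l = 0].
pose Q : set (affine R m) :=
  [set zeta | forall l : affine R m, DF_wrt D L zeta f (m + 2)%:R l = 0].
have PQ : twist_aff f @^-1` P = Q.
  have DFE zeta l : DF_wrt TD TL (twist_aff f zeta) affine1 0 (twist_aff f l) =
      aff_cst f * DF_wrt D L zeta f (m + 2)%:R l.
    apply: DF_wrt_twist => //; last exact: is_twist_affine.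
    by apply: measurable_funTS; exact: measurable_affine.
  apply/seteqP; split=> zeta DF0 l.
    by apply: (mulfI f_neq0); rewrite -DFE DF0 mulr0.
  by rewrite -(twist_aff_invK f_neq0 l) DFE DF0 mulr0.
have P_subset1 : is_subset1 (twist_aff f @^-1` P).
  by rewrite PQ => zeta zeta'; exact: extremal_affine_unique.
have := xget_preimage (Affine 0 0) (twist_aff_invK f_neq0) P_subset1.
by rewrite PQ {1}/twist_aff /= mul0r scale0r subr0.
Qed.

Lemma donaldson_futaki_twist phi psi :
  convex_pl D phi -> is_twist D f phi psi ->
  donaldson_futaki TD TL affine1 0 psi =
  aff_cst f * donaldson_futaki D L f (m + 2)%:R phi.
Proof.
move=> phiC psiE; rewrite /donaldson_futaki extremal_affine_twist.
apply: DF_wrt_twist => //; apply: measurable_convex_pl.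
  exact: measurable_twist_set.
exact/(convex_pl_twist f_neq0 fD psiE).
Qed.

Lemma donaldson_futaki_twist_stable phi psi :
  convex_pl D phi -> is_twist D f phi psi ->
  (0 <= donaldson_futaki TD TL affine1 0 psi /\
    (donaldson_futaki TD TL affine1 0 psi = 0 <-> affine_on TD psi)) <->
  (0 <= donaldson_futaki D L f (m + 2)%:R phi /\
    (donaldson_futaki D L f (m + 2)%:R phi = 0 <-> affine_on D phi)).
Proof.
move=> phiC psiE; rewrite (donaldson_futaki_twist phiC psiE) (pmulr_rge0 _ f0).
rewrite (affine_on_twist f_neq0 fD psiE).
set F := donaldson_futaki _ _ _ _ _.
have FE : aff_cst f * F = 0 <-> F = 0.
  by split=> [/(canRL (mulKf f_neq0))|->]; rewrite mulr0.
by rewrite FE.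
Qed.

Lemma K_stable_twist : fw_K_stable D L f (m + 2)%:R <-> K_stable TD TL.
Proof.
split=> stable => [psi psiC|phi phiC].
  have psiE := is_twist_pull fD psi.
  have phiC := iffLR (convex_pl_twist f_neq0 fD psiE) psiC.
  exact/(donaldson_futaki_twist_stable phiC psiE)/stable.
have psiE := is_twist_push f_neq0 fD phi.
have psiC := iffRL (convex_pl_twist f_neq0 fD psiE) phiC.
exact/(donaldson_futaki_twist_stable phiC psiE)/stable.
Qed.

End stability_twist.

Theorem corollary5p12 (R : realType) (m d : nat) (Delta : set 'rV[R]_m)
    (L : 'I_d -> affine R m) (f : affine R m) :
  labelled_polytope Delta L ->
  Delta 0 ->
  (forall x, Delta x -> 0 < f x) ->
  fw_K_stable Delta L f (m + 2)%:R <->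
  K_stable (twist_set f Delta) (twist_labels f L).
Proof.
move=> [cD iD DE _ _ _] D0 fD; apply: K_stable_twist => //.
  by rewrite -affine0E; exact: fD.
by rewrite DE; exact: measurable_halfspaces.
Qed.
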